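(* Let $G$ be a Lie group that can be equipped with a left-invariant semi-Riemannian metric $g$ for which the Euler-Arnold equation has an idempotent. Then there exists a curve in $G$ such that $G$ has exponential growth along that curve.
   Context: A semi-Riemannian metric is a smooth non-degenerate symmetric 2-tensor field of constant (arbitrary) signature. Let $\mathfrak{g}=T_1G$ be the Lie algebra of $G$. The Euler-Arnold equation of a left-invariant semi-Riemannian metric $g$ is the ordinary differential equation $\dot x=\mathrm{ad}_x^\dagger x$ on $\mathfrak{g}$, where $\dagger$ denotes the adjoint with respect to the pseudo-scalar product $g_1$ on $\mathfrak{g}$. An idempotent is an element $x_0\in\mathfrak{g}$, $x_0\ne 0$, such that $\mathrm{ad}_{x_0}^\dagger x_0=x_0$. $G$ has exponential growth along a curve $p:[0,\infty)\to G$ with $p(0)=1$ if, for any left-invariant Riemannian metric $g_R$ on $G$ with induced distance $d_R$ and norm $\Vert\cdot\Vert$ on $\mathfrak{g}$ given by $(g_R)_1$, one has $d_R(1,p(t))\to\infty$ as $t\to\infty$ and there are constants $c>0$, $C>0$ such that $\Vert \mathrm{Ad}_{p(t)}\Vert\ge C\,e^{c\,d_R(1,p(t))}$ for all $t\ge 0$, where $\Vert \mathrm{Ad}_p\Vert$ is the operator norm. *)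

(* Defs.v *)
From HB Require Import structures.
From mathcomp Require Import all_boot all_order all_algebra.
From mathcomp Require Import all_classical all_reals all_analysis.

Set Implicit Arguments.
Unset Strict Implicit.
Unset Printing Implicit Defensive.

Import Order.TTheory GRing.Theory Num.Theory.
Import numFieldNormedType.Exports.

Local Open Scope classical_set_scope.
Local Open Scope ring_scope.

(** * Smooth maps between normed spaces

    On an open set [U] of a finite-dimensional [V], [f] is of class [C^(k+1)]
    iff it is differentiable on [U] and all its directional derivatives are of
    class [C^k] on [U]. *)

Fixpoint Ck_on (R : realType) (V W : normedModType R) (k : nat) (U : set V)
    (f : V -> W) : Prop :=
  match k with
  | 0 => forall x, U x -> {for x, continuous f}
  | k'.+1 => (forall x, U x -> differentiable f x) /\
             forall v : V, Ck_on k' U ('D_v f)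
  end.

Definition smooth_on (R : realType) (V W : normedModType R) (U : set V)
    (f : V -> W) : Prop := forall k, Ck_on k U f.

(** * Smooth manifolds

    A manifold carries one preferred chart around each point, and these charts
    form the smooth atlas. The tangent space at [p] is ['rV[R]_n]: a tangent
    vector at [p] is given by its coordinates in [chartAt A p]. *)

Record chart (R : realType) (n : nat) (M : topologicalType) := Chart {
  cdom : set M;
  cmap : M -> 'rV[R]_n;
  cinv : 'rV[R]_n -> M;
  cdom_open : open cdom;
  cimg_open : open (cmap @` cdom);
  cmapK : forall p, cdom p -> cinv (cmap p) = p;
  cmap_continuous : forall p, cdom p -> {for p, continuous cmap};
  cinv_continuous : forall z, (cmap @` cdom) z -> {for z, continuous cinv}
}.

Record smoothAtlas (R : realType) (n : nat) (M : topologicalType) :=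
  SmoothAtlas {
  chartAt : M -> chart R n M;
  chartAt_dom : forall p, cdom (chartAt p) p;
  chartAt_smooth : forall p q,
    smooth_on (cmap (chartAt p) @` (cdom (chartAt p) `&` cdom (chartAt q)))
              (cmap (chartAt q) \o cinv (chartAt p))
}.

(** Smoothness, near the point [x], of a map from a normed space to a
    manifold. *)
Definition smooth_at (R : realType) (n : nat) (M : topologicalType)
    (A : smoothAtlas R n M) (V : normedModType R) (f : V -> M) (x : V) : Prop :=
  {for x, continuous f} /\
  forall q, cdom (chartAt A q) (f x) ->
    exists U : set V, [/\ open U, U x & smooth_on U (cmap (chartAt A q) \o f)].

(** * Lie groups *)

#[short(type="topGroupType")]
HB.structure Definition TopGroup := {G of Topological G & Group G}.

(** Smoothness of the operations is expressed in the product of the charts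
    centered at [p] and [q], around the point that represents [(p, q)]. *)
Record lieGroup (R : realType) (n : nat) := LieGroup {
  lieSort :> topGroupType;
  atlas : smoothAtlas R n lieSort;
  lie_hausdorff : hausdorff_space lieSort;
  lie_second_countable : @second_countable lieSort;
  lie_mul_smooth : forall p q : lieSort,
    smooth_at atlas
      (fun z : 'rV[R]_n * 'rV[R]_n =>
         (cinv (chartAt atlas p) z.1 * cinv (chartAt atlas q) z.2)%g)
      (cmap (chartAt atlas p) p, cmap (chartAt atlas q) q);
  lie_inv_smooth : forall p : lieSort,
    smooth_at atlas (fun z => (cinv (chartAt atlas p) z)^-1%g)
      (cmap (chartAt atlas p) p)
}.

Section LieGroupTheory.
Variables (R : realType) (n : nat) (G : lieGroup R n).

Local Notation E := 'rV[R]_n.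
Local Notation chart_ p := (chartAt (atlas G) p).

(** The differential [T_p G -> T_(f p) G]. *)
Definition mdiff (f : G -> G) (p : G) : E -> E :=
  'd (cmap (chart_ (f p)) \o f \o cinv (chart_ p)) (cmap (chart_ p) p).

(** The velocity [gamma'(t)], an element of [T_(gamma t) G]. *)
Definition velocity (gamma : R -> G) (t : R) : E :=
  derive1 (cmap (chart_ (gamma t)) \o gamma) t.

(** Change between coordinates in a chart [c] and the preferred coordinates
    of [T_p G], in both directions. *)
Definition from_chart (c : chart R n G) (p : G) : E -> E :=
  'd (cmap (chart_ p) \o cinv c) (cmap c p).

Definition to_chart (c : chart R n G) (p : G) : E -> E :=
  'd (cmap c \o cinv (chart_ p)) (cmap (chart_ p) p).

(** ** The Lie algebra [T_1 G] *)

(** A vector field [X] in the coordinates of [c]. *)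
Definition field_in_chart (c : chart R n G) (X : G -> E) (z : E) : E :=
  to_chart c (cinv c z) (X (cinv c z)).

(** [[X, Y] = DY(X) - DX(Y)] in local coordinates. *)
Definition field_bracket (X Y : G -> E) (p : G) : E :=
  let c := chart_ p in
  'D_(X p) (field_in_chart c Y) (cmap c p)
  - 'D_(Y p) (field_in_chart c X) (cmap c p).

Definition left_field (x : E) (p : G) : E := mdiff (fun q => p * q)%g 1%g x.

Definition ad (x y : E) : E :=
  field_bracket (left_field x) (left_field y) 1%g.

Definition Ad (p : G) : E -> E := mdiff (fun q => p * q * p^-1)%g 1%g.

(** ** Left-invariant metrics *)

Definition has_index (b : E -> E -> R) (k : nat) : Prop :=
  exists2 P : 'M[R]_n, P \in unitmx &
    forall i j, b (row i P) (row j P) =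
      if i == j then (if (i < k)%N then -1 else 1) else 0.

Record semi_riemannian (g : G -> E -> E -> R) : Prop := SemiRiemannian {
  metric_linear : forall p a u v w,
    g p (a *: u + v) w = a * g p u w + g p v w;
  metric_sym : forall p u v, g p u v = g p v u;
  metric_nondegenerate : forall p u, (forall v, g p u v = 0) -> u = 0;
  metric_smooth : forall q u v,
    let c := chart_ q in
    smooth_on (cmap c @` cdom c)
      (fun z => g (cinv c z) (from_chart c (cinv c z) u)
                             (from_chart c (cinv c z) v) : R^o);
  metric_index : exists2 k, (k <= n)%N & forall p, has_index (g p) k
}.

Definition left_invariant (g : G -> E -> E -> R) : Prop :=
  forall (h p : G) (u v : E),
    g (h * p)%g (mdiff (fun q => h * q)%g p u) (mdiff (fun q => h * q)%g p v)
    = g p u v.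

Definition riemannian (g : G -> E -> E -> R) : Prop :=
  semi_riemannian g /\ forall p v, v != 0 -> 0 < g p v v.

(** ** The Euler-Arnold equation *)

(** The adjoint of [T] for [b]; when [b] is non-degenerate and [T] is linear,
    there is exactly one such [w]. *)
Definition dagger (b : E -> E -> R) (T : E -> E) (v : E) : E :=
  xget 0 [set w | forall u, b (T u) v = b u w].

(** The right-hand side of the equation [x' = ad_x^dagger x]. *)
Definition euler_arnold (g : G -> E -> E -> R) (x : E) : E :=
  dagger (g 1%g) (ad x) x.

Definition is_idempotent (g : G -> E -> E -> R) (x : E) : Prop :=
  x != 0 /\ euler_arnold g x = x.

(** ** Riemannian distance and exponential growth *)

Definition bnorm (b : E -> E -> R) (v : E) : R := Num.sqrt (b v v).

Definition opnorm (b : E -> E -> R) (T : E -> E) : R :=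
  sup [set bnorm b (T v) | v in [set v | bnorm b v <= 1]].

Definition curve_length (g : G -> E -> E -> R) (gamma : R -> G) : \bar R :=
  (\int[lebesgue_measure]_(t in `[0%R, 1%R])
     (bnorm (g (gamma t)) (velocity gamma t))%:E)%E.

(** [path_of_length g p q l]: there is a piecewise smooth path of length [l]
    from [p] to [q], each smooth piece being parametrized by [[0, 1]]. *)
Inductive path_of_length (g : G -> E -> E -> R) (p : G) :
    G -> \bar R -> Prop :=
| path_nil : path_of_length g p p 0%E
| path_rcons q l (gamma : R -> G) :
    path_of_length g p q l ->
    gamma 0 = q ->
    (forall t, 0 <= t <= 1 -> smooth_at (atlas G) gamma t) ->
    path_of_length g p (gamma 1) (l + curve_length g gamma)%E.

(** The value is [+oo] when [p] and [q] are in distinct components. *)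
Definition rdist (g : G -> E -> E -> R) (p q : G) : \bar R :=
  ereal_inf [set l | path_of_length g p q l].

(** Curves defined on the half-line t >= 0; the values of [p] at negative arguments
    only serve to express smoothness at [0] (existence of a smooth extension to
    a neighborhood of [0]). *)
Definition smooth_curve (p : R -> G) : Prop :=
  forall t, 0 <= t -> smooth_at (atlas G) p t.

Definition exponential_growth_along (p : R -> G) : Prop :=
  p 0 = 1%g /\
  forall g, riemannian g -> left_invariant g ->
    rdist g 1%g (p t) @[t --> +oo] --> +oo%E /\
    exists c C : R, [/\ 0 < c, 0 < C & forall t : R, 0 <= t ->
      (C%:E * expeR (c%:E * rdist g 1%g (p t))
       <= (opnorm (g 1%g) (Ad (p t)))%:E)%E].

End LieGroupTheory.

(* Main.v *)
Require Import Defs.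
From HB Require Import structures.
From mathcomp Require Import all_boot all_order all_algebra.
From mathcomp Require Import all_classical all_reals all_analysis.
From mathcomp Require Import ring lra.
From mathcomp.real_closed Require Import complex.

(** Let [x] be an idempotent and [lam = g_1(-, x)]. The equation
    [ad_x^dagger x = x] says that [lam] is fixed by the transpose of [ad x], so
    [ad x] has the eigenvalue [1] ([idempotent_eigen]). Since [ad] is the
    derivative of [Ad] at the identity ([derive_Ad]), [Ad] should grow like
    [exp t] along the one-parameter subgroup of [x], while the distance to the
    identity grows at most linearly in [t].

    Instead of the one-parameter subgroup, which requires solving a differential
    equation, the proof uses the powers of a single element [h = seg x e] lying
    at small parameter [e] on a coordinate line with velocity [x]. The matrix
    [(Ad h - 1) / e] is close to that of [ad x], so [det (1 - (Ad h - 1) / e)] is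
    close to [0] and [Ad h] has a complex eigenvalue of modulus at least
    [r = 1 + e / 2] ([eigen_step], [det_growth]). Thus the entries of [Ad (h ^ k)]
    grow at least like [r ^ k]. The curve follows the coordinate line from [1] to
    [h], then its translate from [h] to [h ^ 2], and so on, reparametrized by a
    smooth step function that is constant outside the unit interval
    ([smooth_step]); hence it is smooth at the integers ([step_curve]).

    Fix a left-invariant Riemannian metric. The translated steps have the same
    bounded length, so the distance from [1] to the point at time [t] in
    [[k, k + 1]] is at most [(k + 1) L] ([rdist_steps]); together with the growth
    of [Ad] this is the exponential bound. Conversely, along any path the
    derivative of [Ad] is [Ad] composed with [ad] of the translated velocity,
    whose norm is the speed; so [ln (1 + |Ad|^2)] increases by at most a constant
    times the length ([log_sqnorm_path]). As the norm of [Ad] tends to infinity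
    along the curve, so does the distance.

    The identity [derive_Ad] compares two mixed second derivatives of
    multiplication in a chart and rests on their symmetry ([schwarz]). *)

Set Implicit Arguments.
Unset Strict Implicit.
Unset Printing Implicit Defensive.

Import Order.TTheory GRing.Theory Num.Theory.
Import numFieldNormedType.Exports.

Local Open Scope classical_set_scope.
Local Open Scope ring_scope.

(** * Calculus of functions of class [C^k] *)

Section Ck.
Variable R : realType.
Implicit Types (V W X : normedModType R).

Lemma scale_is_bilinear W :
  bilinear_for
    (GRing.Scale.Law.clone _ _ *:%R _) (GRing.Scale.Law.clone _ _ *:%R _)
    (@GRing.scale R W : R -> W -> W).
Proof.
by split=> [u'|u] a x y /=; rewrite ?scalerDl ?scalerDr ?scalerA // mulrC.
Qed.
HB.instance Definition _ W := bilinear_isBilinear.Build R R W W _ _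
  (@GRing.scale R W : R -> W -> W) (@scale_is_bilinear W).

Lemma is_diff_scale V W (k : V -> R) (f : V -> W) x :
  differentiable k x -> differentiable f x ->
  is_diff x (fun z => k z *: f z) (fun v => k x *: 'd f x v + 'd k x v *: f x).
Proof.
move=> dk df.
have sc : continuous (fun p : R * W => p.1 *: p.2).
  by move=> p; apply: cvgZ; [exact: cvg_fst|exact: cvg_snd].
have db : differentiable (fun p : R * W => p.1 *: p.2) (k x, f x).
  exact: (@differentiable_bilin _ _ _ _ (@GRing.scale R W : R -> W -> W)).
have dp : differentiable (fun z => (k z, f z)) x by exact: differentiable_pair.
have -> : (fun z => k z *: f z) =
  (fun p : R * W => p.1 *: p.2) \o (fun z => (k z, f z)) by [].
apply: DiffDef; first exact: differentiable_comp.
rewrite diff_comp // diff_pair //; apply/funext => v /=.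
by have /= -> := @diff_bilin _ _ _ _ (@GRing.scale R W : R -> W -> W) (k x, f x) sc.
Qed.

(** The differential is determined by the values near the point; both functions
    have the same expansion there. *)
Lemma near_eq_differentiable V W (f g : V -> W) x :
  (\near x, f x = g x) -> differentiable f x -> differentiable g x.
Proof.
move=> fg df; apply/diff_locallyP.
have gx : g x = f x by rewrite (nbhs_singleton fg).
suff H : g \o shift x = cst (g x) + 'd f x +o_ 0 id.
  have c : continuous ('d f x) by exact: diff_continuous.
  have e := diff_unique c H.
  by split; rewrite e.
have [_ H] := (diff_locallyP _ _).1 df.
apply/eqaddoP => e e0; move/eqaddoP : H => /(_ e e0).
have : \forall y \near (0 : V), f (y + x) = g (y + x).
  have := fg; rewrite (near_shift 0) /=.
  by apply: filterS => y; rewrite /= subr0.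
apply: filterS2 => y E; rewrite -![(_ + _ : _ -> _) _]/(_ + _).
by rewrite -![(- _ : _ -> _) _]/(- _) -![(_ + _ : _ -> _) _]/(_ + _) /= gx E.
Qed.

Lemma near_eq_diff V W (f g : V -> W) x :
  (\near x, f x = g x) -> differentiable f x -> 'd f x = 'd g x :> (V -> W).
Proof.
move=> fg df; apply/funext => v; rewrite -!deriveE //; first exact: near_eq_derive.
exact: near_eq_differentiable fg df.
Qed.

(** The chain rule for a map that factors only near the point, as do the
    expressions of a map in two different charts. *)
Lemma diff_factor V W X (u : V -> W) (g : W -> X) (f : V -> X) x :
  (\near x, f x = g (u x)) -> differentiable u x -> differentiable g (u x) ->
  'd f x = 'd g (u x) \o 'd u x :> (V -> X).
Proof.
move=> fg du dg; apply: etrans _ (diff_comp du dg).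
have gf : \near x, (g \o u) x = f x by apply: filterS fg => y ->.
apply/esym; apply: near_eq_diff gf _; exact: differentiable_comp.
Qed.

Lemma Ck_on_ext k V W (U : set V) (f g : V -> W) : open U ->
  (forall x, U x -> f x = g x) -> Ck_on k U f -> Ck_on k U g.
Proof.
move=> oU; elim: k f g => [|k IH] f g fg /=.
  move=> cf x Ux; have n : \near x, f x = g x.
    by apply: filterS (open_nbhs_nbhs (conj oU Ux)).
  rewrite /prop_for /continuous_at -(fg _ Ux).
  by apply: (cvg_trans _ (cf _ Ux)); exact: near_eq_cvg.
move=> [df Df]; have n x : U x -> \near x, f x = g x.
  by move=> Ux; apply: filterS (open_nbhs_nbhs (conj oU Ux)).
split=> [x Ux|v]; first exact: near_eq_differentiable (n _ Ux) (df _ Ux).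
by apply: IH (Df v) => x Ux; exact: near_eq_derive (n _ Ux).
Qed.

Lemma Ck_on_cont k V W (U : set V) (f : V -> W) x :
  Ck_on k U f -> U x -> {for x, continuous f}.
Proof.
case: k => [|k] /=; first by move=> + Ux => /(_ _ Ux).
by move=> [df _] Ux; exact/differentiable_continuous/df.
Qed.

Lemma Ck_onS k V W (U : set V) (f : V -> W) : Ck_on k.+1 U f -> Ck_on k U f.
Proof.
elim: k f => [|k IH] f.
  by move=> Cf x Ux; exact: Ck_on_cont Cf Ux.
by move=> [df Df]; split => // v; exact/IH/Df.
Qed.

Lemma Ck_on_sub k V W (U U' : set V) (f : V -> W) :
  U' `<=` U -> Ck_on k U f -> Ck_on k U' f.
Proof.
move=> UU; elim: k f => [|k IH] f /=; first by move=> + x /UU => /[apply].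
by move=> [df Df]; split => [x /UU /df //|v]; exact/IH/Df.
Qed.

Lemma Ck_on_cst k V W (U : set V) (w : W) : Ck_on k U (fun=> w : W).
Proof.
elim: k w => [|k IH] w /=; first by move=> x _; exact: cst_continuous.
split=> [x _|v]; first exact: differentiable_cst.
rewrite (_ : 'D_v _ = fun=> 0) //; apply/funext => x.
exact: (@derive_cst R V W w x v).
Qed.

Lemma Ck_on_lin k V W (U : set V) (f : {linear V -> W}) : continuous f ->
  Ck_on k U f.
Proof.
move=> cf; case: k => [|k] /=; first by move=> x _; exact: cf.
split=> [x _|v]; first exact: linear_differentiable.
rewrite (_ : 'D_v _ = fun=> f v); first exact: Ck_on_cst.
by apply/funext => x; rewrite deriveE; [rewrite diff_lin|exact: linear_differentiable].
Qed.

Lemma Ck_onD k V W (U : set V) (f g : V -> W) : open U ->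
  Ck_on k U f -> Ck_on k U g -> Ck_on k U (fun x => f x + g x).
Proof.
move=> oU; elim: k f g => [|k IH] f g /=.
  by move=> cf cg x Ux; exact: continuousD (cf _ Ux) (cg _ Ux).
move=> [df Df] [dg Dg]; split=> [x Ux|v].
  exact: differentiableD (df _ Ux) (dg _ Ux).
apply: Ck_on_ext (IH _ _ (Df v) (Dg v)) => // x Ux.
by rewrite -deriveD //; apply/diff_derivable; [exact: df|exact: dg].
Qed.

Lemma Ck_on_sum k V W (U : set V) (m : nat) (f : 'I_m -> V -> W) : open U ->
  (forall i, Ck_on k U (f i)) -> Ck_on k U (fun x => \sum_(i < m) f i x).
Proof.
move=> oU; elim: m f => [|m IH] f Cf.
  by under eq_fun do rewrite big_ord0; exact: Ck_on_cst.
under eq_fun do rewrite big_ord_recr /=.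
by apply: Ck_onD => //; exact: IH.
Qed.

Lemma Ck_onZ k V W (U : set V) (a : V -> R) (f : V -> W) : open U ->
  Ck_on k U a -> Ck_on k U f -> Ck_on k U (fun x => a x *: f x).
Proof.
move=> oU; elim: k a f => [|k IH] a f.
  by move=> ca cf x Ux; exact: continuousZ (ca _ Ux) (cf _ Ux).
move=> Ca Cf; have [da Da] := Ca; have [df Df] := Cf; split=> [x Ux|v].
  by have [] := is_diff_scale (da _ Ux) (df _ Ux).
apply: (@Ck_on_ext _ _ _ _ (fun x => a x *: 'D_v f x + 'D_v a x *: f x)) => //.
  move=> x Ux; have [E1 E2] := is_diff_scale (da _ Ux) (df _ Ux).
  rewrite [RHS]deriveE // E2.
  by rewrite (deriveE v (df _ Ux)) (deriveE v (da _ Ux)).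
apply: Ck_onD => //.
  exact: IH (Ck_onS Ca) (Df v).
exact: IH (Da v) (Ck_onS Cf).
Qed.

Lemma Ck_on_linl k V W X (U : set V) (L : {linear W -> X}) (f : V -> W) :
  open U -> continuous L -> Ck_on k U f -> Ck_on k U (L \o f).
Proof.
move=> oU cL; elim: k f => [|k IH] f.
  by move=> cf x Ux; apply: continuous_comp; [exact: cf|exact: cL].
have dL y : differentiable L y by exact: linear_differentiable.
move=> [df Df]; split=> [x Ux|v].
  by apply: differentiable_comp; [exact: df|exact: dL].
apply: Ck_on_ext (IH _ (Df v)) => // x Ux.
have dfx := df _ Ux; rewrite [RHS]deriveE; last exact: differentiable_comp.
by rewrite diff_comp //= diff_lin // deriveE.
Qed.

(** Coordinates in a finite basis: through them a derivative along a moving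
    direction becomes a combination of derivatives along fixed directions,
    which is what lets the chain rule be iterated. *)
Definition has_coords W :=
  exists (m : nat) (e : 'I_m -> W) (c : 'I_m -> {linear W -> R}),
  (forall i, continuous (c i)) /\ forall w, w = \sum_i c i w *: e i.

Lemma Ck_on_pair k V W X (U : set V) (f : V -> W) (g : V -> X) : open U ->
  Ck_on k U f -> Ck_on k U g -> Ck_on k U (fun x => (f x, g x)).
Proof.
move=> oU; elim: k f g => [|k IH] f g.
  move=> cf cg x Ux; exact: (cvg_pair (cf _ Ux) (cg _ Ux)).
move=> [df Df] [dg Dg]; split=> [x Ux|v].
  exact: differentiable_pair (df _ Ux) (dg _ Ux).
apply: Ck_on_ext (IH _ _ (Df v) (Dg v)) => // x Ux.
have [? ?] := (df _ Ux, dg _ Ux).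
by rewrite [RHS]deriveE ?diff_pair ?deriveE //; exact: differentiable_pair.
Qed.

(** The derivative of [g \o f] along [v] is the combination of the [g]-derivatives
    along the basis vectors [e i] with coefficients [c i ('D_v f)]; both factors
    are of class one less, so induction on [k] applies. *)
Lemma Ck_on_comp k V W X (U : set V) (U' : set W) (f : V -> W) (g : W -> X) :
  has_coords W -> open U -> (forall x, U x -> U' (f x)) ->
  Ck_on k U f -> Ck_on k U' g -> Ck_on k U (g \o f).
Proof.
move=> [m [e [c [cc ec]]]] oU UU'; elim: k f g UU' => [|k IH] f g UU'.
  move=> cf cg x Ux; apply: continuous_comp; first exact: cf.
  exact/cg/UU'.
move=> Cf [dg Dg]; have [df Df] := Cf; split=> [x Ux|v].
  by apply: differentiable_comp; [exact: df|exact/dg/UU'].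
apply: (@Ck_on_ext _ _ _ _
  (fun x => \sum_(i < m) c i ('D_v f x) *: ('D_(e i) g \o f) x)) => //.
  move=> x Ux; have [dfx dgx] := (df _ Ux, dg _ (UU' _ Ux)).
  rewrite [RHS]deriveE; last exact: differentiable_comp.
  rewrite diff_comp //= [in RHS](ec ('d f x v)) linear_sum /=.
  by apply: eq_bigr => i _; rewrite linearZ /= !deriveE.
apply: Ck_on_sum => // i; apply: Ck_onZ => //; last first.
  exact: IH UU' (Ck_onS Cf) (Dg _).
apply: (@Ck_on_linl _ _ _ _ _ (c i) _ oU (cc i)).
exact: Df.
Qed.
End Ck.

(** * Germs of smooth functions, and symmetry of second derivatives *)

Section Germs.
Variable R : realType.
Implicit Types (V W X : normedModType R).

Definition smooth_germ V W (f : V -> W) (x : V) :=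
  exists U : set V, [/\ open U, U x & smooth_on U f].

Lemma germ_ext V W (f g : V -> W) x :
  (\near x, f x = g x) -> smooth_germ f x -> smooth_germ g x.
Proof.
move=> fg [U [oU Ux sf]].
exists (U `&` [set y | f y = g y]^°); split.
- by apply: openI => //; exact: open_interior.
- by split => //; rewrite /interior /=.
- move=> k; apply: (@Ck_on_ext _ _ _ _ _ f).
  + by apply: openI => //; exact: open_interior.
  + by move=> y [_ /interior_subset].
  + by apply: Ck_on_sub (sf k) => y [].
Qed.

Lemma germ_near V W (f : V -> W) x :
  smooth_germ f x -> \near x, smooth_germ f x.
Proof.
move=> [U [oU Ux sf]]; apply: filterS (open_nbhs_nbhs (conj oU Ux)) => y Uy.
by exists U.
Qed.

Lemma germ_diff V W (f : V -> W) x : smooth_germ f x -> differentiable f x.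
Proof. by move=> [U [oU Ux /(_ 1%N)[+ _]]]; apply. Qed.

Lemma germ_cont V W (f : V -> W) x : smooth_germ f x -> {for x, continuous f}.
Proof. by move=> /germ_diff/differentiable_continuous. Qed.

Lemma germ_derive V W (f : V -> W) v x : smooth_germ f x ->
  smooth_germ ('D_v f) x.
Proof.
by move=> [U [oU Ux sf]]; exists U; split => // k; have [_] := sf k.+1; apply.
Qed.

Lemma germ_comp V W X (f : V -> W) (g : W -> X) x : has_coords W ->
  smooth_germ f x -> smooth_germ g (f x) -> smooth_germ (g \o f) x.
Proof.
move=> cW [U [oU Ux sf]] [U' [oU' Ux' sg]].
have oUU : open (U `&` f @^-1` U').
  rewrite openE => y [Uy U'y]; rewrite /interior /=; apply: filterI.
    exact: open_nbhs_nbhs (conj oU Uy).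
  apply: (Ck_on_cont (sf 0%N) Uy).
  exact: open_nbhs_nbhs (conj oU' U'y).
exists (U `&` f @^-1` U'); split => // k.
apply: (@Ck_on_comp _ _ _ _ _ _ U') => //; first by move=> y [].
by apply: Ck_on_sub (sf k) => y [].
Qed.

Let germ2 V W X (f : V -> W) (g : V -> X) x :
  smooth_germ f x -> smooth_germ g x ->
  exists U, [/\ open U, U x, smooth_on U f & smooth_on U g].
Proof.
move=> [U [oU Ux sf]] [U' [oU' Ux' sg]]; exists (U `&` U'); split => //.
- exact: openI.
- by move=> k; apply: Ck_on_sub (sf k) => y [].
- by move=> k; apply: Ck_on_sub (sg k) => y [].
Qed.

Lemma germ_pair V W X (f : V -> W) (g : V -> X) x :
  smooth_germ f x -> smooth_germ g x -> smooth_germ (fun y => (f y, g y)) x.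
Proof.
move=> sf sg; have [U [oU Ux {}sf {}sg]] := germ2 sf sg.
by exists U; split => // k; exact: Ck_on_pair.
Qed.

Lemma germD V W (f : V -> W) (g : V -> W) x :
  smooth_germ f x -> smooth_germ g x -> smooth_germ (fun y => f y + g y) x.
Proof.
move=> sf sg; have [U [oU Ux {}sf {}sg]] := germ2 sf sg.
by exists U; split => // k; exact: Ck_onD.
Qed.

Lemma germZ V W (f : V -> R) (g : V -> W) x :
  smooth_germ f x -> smooth_germ g x -> smooth_germ (fun y => f y *: g y) x.
Proof.
move=> sf sg; have [U [oU Ux {}sf {}sg]] := germ2 sf sg.
by exists U; split => // k; exact: Ck_onZ.
Qed.

Lemma germ_cst V W (w : W) (x : V) : smooth_germ (fun=> w) x.
Proof. by exists setT; split => //; [exact: openT|move=> k; exact: Ck_on_cst]. Qed.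

Lemma germ_lin V W (f : {linear V -> W}) x : continuous f -> smooth_germ f x.
Proof. by exists setT; split => //; [exact: openT|move=> k; exact: Ck_on_lin]. Qed.

Lemma germ_sum V W m (f : 'I_m -> V -> W) x :
  (forall i, smooth_germ (f i) x) -> smooth_germ (fun y => \sum_(i < m) f i y) x.
Proof.
elim: m f => [|m IH] f sf.
  by under eq_fun do rewrite big_ord0; exact: germ_cst.
under eq_fun do rewrite big_ord_recr /=.
by apply: germD => //; exact: IH.
Qed.

Lemma germ_id V (x : V) : smooth_germ (fun y => y) x.
Proof. by apply: (@germ_lin V V idfun) => y; exact: cvg_id. Qed.

Lemma germ_fst V W (x : V * W) : smooth_germ (fun p : V * W => p.1) x.
Proof. by apply: (@germ_lin _ _ fst) => y; exact: cvg_fst. Qed.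

Lemma germ_snd V W (x : V * W) : smooth_germ (fun p : V * W => p.2) x.
Proof. by apply: (@germ_lin _ _ snd) => y; exact: cvg_snd. Qed.

Lemma has_coords_R : has_coords R.
Proof.
exists 1%N, (fun=> 1), (fun=> idfun); split => [_ y|w]; first exact: cvg_id.
by rewrite big_ord1 /= [RHS]mulr1.
Qed.

Definition coordf n (j : 'I_n) : 'rV[R]_n -> R := fun v => v ord0 j.

Lemma coordf_linear n (j : 'I_n) : linear (coordf j).
Proof. by move=> a u v; rewrite /coordf !mxE. Qed.
HB.instance Definition _ n (j : 'I_n) :=
  GRing.isLinear.Build R 'rV[R]_n R _ (coordf j) (coordf_linear j).

Lemma coordf_cont n (j : 'I_n) : continuous (coordf j).
Proof. exact: coord_continuous. Qed.

Lemma has_coords_rV n : has_coords 'rV[R]_n.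
Proof.
exists n, (fun j => delta_mx ord0 j), (@coordf n); split; first exact: coordf_cont.
by move=> w; rewrite {1}[w]row_sum_delta.
Qed.

Lemma has_coords_prod V W : has_coords V -> has_coords W ->
  has_coords (V * W)%type.
Proof.
move=> [m1 [e1 [c1 [cc1 ce1]]]] [m2 [e2 [c2 [cc2 ce2]]]].
exists (m1 + m2)%N, (fun i => match fintype.split i with
   inl i => (e1 i, 0) | inr i => (0, e2 i) end),
 (fun i => match fintype.split i return {linear (V * W)%type -> R} with
   | inl i => [the {linear (V * W)%type -> R} of (c1 i \o fst)%FUN]
   | inr i => [the {linear (V * W)%type -> R} of (c2 i \o snd)%FUN] end); split.
  move=> i; case: fintype.split => {}i x /=; apply: continuous_comp.
  - exact: cvg_fst.
  - exact: cc1.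
  - exact: cvg_snd.
  - exact: cc2.
move=> [v w]; rewrite big_split_ord /=.
under eq_bigr do rewrite (unsplitK (inl _)) /=.
under [X in _ = _ + X]eq_bigr do rewrite (unsplitK (inr _)) /=.
rewrite [in LHS](ce1 v) [in LHS](ce2 w).
apply/eqP; rewrite xpair_eqE /=; apply/andP; split; apply/eqP.
- rewrite !raddf_sum /= [X in _ + X]big1 ?addr0//; move=> i _ /=.
  by rewrite scaler0.
- rewrite !raddf_sum /= [X in X + _]big1 ?add0r// => i _ /=.
  by rewrite scaler0.
Qed.
End Germs.
Arguments coordf {R n} j v.

Section Schwarz.
Variables (R : realType) (V : normedModType R).

Lemma is_derive_line (W : normedModType R) (f : V -> W) (y v : V) (t : R) :
  differentiable f (y + t *: v) ->
  is_derive t (1 : R) (fun t : R => f (y + t *: v)) ('D_v f (y + t *: v)).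
Proof.
move=> df.
have [dl El] : is_diff t (fun t : R => y + t *: v) (fun s : R => 0 + s *: v).
  exact: (@is_diffD _ _ _ (fun=> y) (fun t : R => t *: v)).
have dc : differentiable (f \o (fun t : R => y + t *: v)) t.
  exact: differentiable_comp.
split; first exact/derivable1_diffP.
by rewrite [LHS]deriveE // diff_comp //= El deriveE // add0r scale1r.
Qed.

(** The mean value theorem, applied in each variable in turn, turns a double
    difference quotient into a mixed second derivative at a nearby point. *)
Lemma double_difference (f : V -> R) (x v w : V) (h : R) : 0 < h ->
  (forall a b : R, 0 <= a <= h -> 0 <= b <= h ->
     differentiable f (x + b *: w + a *: v) /\
     differentiable ('D_v f) (x + a *: v + b *: w)) ->
  exists a b : R, [/\ 0 <= a <= h, 0 <= b <= h &
    f (x + h *: w + h *: v) - f (x + h *: v) - f (x + h *: w) + f x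
    = 'D_w ('D_v f) (x + a *: v + b *: w) * h ^+ 2].
Proof.
move=> h0 D.
pose g (s : R) : R := f (x + h *: w + s *: v) - f (x + 0 *: w + s *: v).
pose g' (s : R) : R := 'D_v f (x + h *: w + s *: v) - 'D_v f (x + 0 *: w + s *: v).
have hh : 0 <= h <= h by rewrite (ltW h0) lexx.
have oh : (0 : R) <= 0 <= h by rewrite lexx (ltW h0).
have dg (s : R) : s \in `[0, h] -> is_derive s (1 : R) (g : R -> R) (g' s).
  rewrite in_itv /= => sh; apply: is_deriveB.
    exact: is_derive_line (D _ _ sh hh).1.
  exact: is_derive_line (D _ _ sh oh).1.
have [a] := MVT h0 (fun s sh => dg s (subset_itv_oo_cc sh))
  (derivable_within_continuous (fun s sh => @ex_derive _ _ _ _ _ _ _ (dg s sh))).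
rewrite in_itv /= => /andP[a0 ah] Eg.
have aah : 0 <= a <= h by rewrite !ltW.
pose k (s : R) : R := 'D_v f (x + a *: v + s *: w).
pose k' (s : R) : R := 'D_w ('D_v f) (x + a *: v + s *: w).
have dk (s : R) : s \in `[0, h] -> is_derive s (1 : R) (k : R -> R) (k' s).
  rewrite in_itv /= => sh.
  exact: is_derive_line (D _ _ aah sh).2.
have [b] := MVT h0 (fun s sh => dk s (subset_itv_oo_cc sh))
  (derivable_within_continuous (fun s sh => @ex_derive _ _ _ _ _ _ _ (dk s sh))).
rewrite in_itv /= => /andP[b0 bh] Ek.
exists a, b; split; rewrite ?ltW //.
move: Eg Ek; rewrite /g /g' /k /k' !subr0 !scale0r !addr0 => Eg Ek.
transitivity (f (x + h *: w + h *: v) - f (x + h *: v) - (f (x + h *: w) - f x)).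
  by rewrite opprB [in RHS]addrCA addrC -!addrA.
by rewrite Eg [x + h *: w + a *: v]addrAC Ek expr2 mulrA.
Qed.

Lemma near_corner (P : V -> Prop) (x v w : V) : (\near x, P x) ->
  exists2 h : R, 0 < h & forall a b : R, 0 <= a <= h -> 0 <= b <= h ->
    P (x + a *: v + b *: w).
Proof.
move=> /nbhs_ballP[e /= e0 He]; have k0 : 0 < `|v| + `|w| + 1.
  by rewrite ltr_wpDl.
exists (e / (`|v| + `|w| + 1)); first by rewrite divr_gt0.
move=> a b /andP[a0 ah] /andP[b0 bh]; apply: He; rewrite -ball_normE /=.
rewrite -addrA opprD addNKr normrN (le_lt_trans (ler_normD _ _)) //.
rewrite !normrZ !ger0_norm //.
apply: (@le_lt_trans _ _ (e / (`|v| + `|w| + 1) * (`|v| + `|w|))).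
  by rewrite mulrDr lerD // ler_wpM2r.
by rewrite mulrAC -mulrA gtr_pMr // ltr_pdivrMr // mul1r ltrDl.
Qed.

(** The double difference is symmetric in the two directions, so both mixed
    derivatives take a common value at points arbitrarily close to [x]; by
    continuity they agree at [x]. *)
Theorem schwarz (f : V -> R) (x v w : V) : smooth_germ f x ->
  'D_v ('D_w f) x = 'D_w ('D_v f) x.
Proof.
move=> sf.
pose A y : R := 'D_v ('D_w f) y; pose B y : R := 'D_w ('D_v f) y.
suff H e : 0 < e -> `|A x - B x| <= e.
  apply/eqP; rewrite -subr_eq0 -normr_le0; apply/ler_addgt0Pr => e e0.
  by rewrite add0r; exact: H.
move=> e0.
have e20 : 0 < e / 2 by rewrite divr_gt0.
have c1 : {for x, continuous A} := germ_cont (germ_derive v (germ_derive w sf)).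
have c2 : {for x, continuous B} := germ_cont (germ_derive w (germ_derive v sf)).
have N1 : \forall y \near x, `|A x - A y| < e / 2.
  by move/cvgrPdist_lt : c1; apply.
have N2 : \forall y \near x, `|B x - B y| < e / 2.
  by move/cvgrPdist_lt : c2; apply.
have [h h0 H] := near_corner v w (filterI (germ_near sf) (filterI N1 N2)).
have [|a [b [Ha Hb E1]]] := @double_difference f x v w h h0.
  move=> a b Ha Hb; have [g _] := H _ _ Ha Hb; split.
    by rewrite addrAC; exact: germ_diff.
  exact/germ_diff/germ_derive.
have [|b' [a' [Hb' Ha' E2]]] := @double_difference f x w v h h0.
  move=> ? ? Hb0 Ha0; have [g _] := H _ _ Ha0 Hb0; split; first exact: germ_diff.
  by rewrite addrAC; exact/germ_diff/germ_derive.
have E : B (x + a *: v + b *: w) = A (x + a' *: v + b' *: w).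
  have h2 : h ^+ 2 != 0 by rewrite expf_neq0 // gt_eqF.
  have E12 : B (x + a *: v + b *: w) * h ^+ 2 = A (x + b' *: w + a' *: v) * h ^+ 2.
    apply: etrans (esym E1) _; apply: etrans _ E2.
    rewrite [x + h *: v + h *: w]addrAC; congr (_ + _).
    exact: addrAC.
  by rewrite [x + a' *: v + b' *: w]addrAC; exact: (mulIf h2 E12).
have [_ [_ Bab]] := H _ _ Ha Hb; have [_ [Aab _]] := H _ _ Ha' Hb'.
have -> : A x - B x = (A x - A (x + a' *: v + b' *: w)) +
    (B (x + a *: v + b *: w) - B x) by rewrite E subrKA.
apply: le_trans (ler_normD _ _) _; rewrite (splitr e); apply: lerD.
  exact: ltW Aab.
by rewrite distrC; exact: ltW Bab.
Qed.
End Schwarz.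

(** * Maps into manifolds and Lie groups *)

Section Manifold.
Variables (R : realType) (n : nat) (M : topologicalType) (A : smoothAtlas R n M).
Implicit Types (V W : normedModType R).
Local Notation E := 'rV[R]_n.
Local Notation chart_ p := (chartAt A p).

Lemma cimg_dom (c : chart R n M) z : (cmap c @` cdom c) z -> cdom c (cinv c z).
Proof. by move=> [p cp <-]; rewrite cmapK. Qed.

Lemma cimgK (c : chart R n M) z : (cmap c @` cdom c) z -> cmap c (cinv c z) = z.
Proof. by move=> [p cp <-]; rewrite cmapK. Qed.

Lemma near_cimg (c : chart R n M) p : cdom c p ->
  \forall z \near cmap c p, (cmap c @` cdom c) z.
Proof.
by move=> cp; apply: open_nbhs_nbhs; split; [exact: cimg_open|exists p].
Qed.

Lemma near_cdom (c : chart R n M) V (f : V -> M) x :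
  {for x, continuous f} -> cdom c (f x) -> \forall y \near x, cdom c (f y).
Proof.
by move=> cf cx; apply: cf; apply: open_nbhs_nbhs; split; [exact: cdom_open|].
Qed.

Lemma germ_transition p q r : cdom (chart_ p) r -> cdom (chart_ q) r ->
  smooth_germ (cmap (chart_ q) \o cinv (chart_ p)) (cmap (chart_ p) r).
Proof.
move=> pr qr.
pose S := cmap (chart_ p) @` (cdom (chart_ p) `&` cdom (chart_ q)).
exists (interior S); split; first exact: open_interior.
- have ci : {for cmap (chart_ p) r, continuous (cinv (chart_ p))}.
    by apply: cinv_continuous; exists r.
  have : \forall z \near cmap (chart_ p) r, cdom (chart_ q) (cinv (chart_ p) z).
    by apply: near_cdom; rewrite ?cmapK.
  rewrite /interior /=; have := near_cimg pr; apply: filterS2 => z zi zq.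
  by exists (cinv (chart_ p) z); rewrite ?cimgK //; split=> //; exact: cimg_dom.
- by move=> k; apply: Ck_on_sub (@chartAt_smooth _ _ _ A p q k); exact: interior_subset.
Qed.

Lemma smooth_at_germ V (f : V -> M) x q : smooth_at A f x ->
  cdom (chart_ q) (f x) -> smooth_germ (cmap (chart_ q) \o f) x.
Proof. by move=> [_]; apply. Qed.

(** Smoothness in one chart suffices, since transition maps are smooth. *)
Lemma germ_smooth_at V (f : V -> M) x q : {for x, continuous f} ->
  cdom (chart_ q) (f x) -> smooth_germ (cmap (chart_ q) \o f) x ->
  smooth_at A f x.
Proof.
move=> cf qx sf; split => // r rx.
suff H : smooth_germ (cmap (chart_ r) \o f) x by [].
apply: (@germ_ext _ _ _
  ((cmap (chart_ r) \o cinv (chart_ q)) \o (cmap (chart_ q) \o f))).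
  have := near_cdom cf qx; apply: filterS => y qy /=.
  by rewrite cmapK.
exact: germ_comp (has_coords_rV _ _) sf (germ_transition qx rx).
Qed.

Lemma smooth_at_ext V (f g : V -> M) x : (\near x, f x = g x) ->
  smooth_at A f x -> smooth_at A g x.
Proof.
move=> fg sf; have fx := nbhs_singleton fg.
apply: (@germ_smooth_at _ _ _ (f x)).
- rewrite /prop_for /continuous_at -fx.
  by apply: (cvg_trans _ sf.1); exact: near_eq_cvg.
- by rewrite -fx; exact: chartAt_dom.
- apply: (@germ_ext _ _ _ (cmap (chart_ (f x)) \o f)).
    by apply: filterS fg => y /= ->.
  exact: smooth_at_germ (chartAt_dom _ _).
Qed.

Lemma smooth_at_comp V W (u : V -> W) (m : W -> M) x : has_coords W ->
  smooth_germ u x -> smooth_at A m (u x) -> smooth_at A (m \o u) x.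
Proof.
move=> cW su sm; apply: (@germ_smooth_at _ _ _ (m (u x))).
- by apply: continuous_comp; [exact: germ_cont|exact: sm.1].
- exact: chartAt_dom.
- rewrite (compA (cmap (chart_ (m (u x)))) m u).
  by apply: germ_comp => //; exact: smooth_at_germ (chartAt_dom _ _).
Qed.

Lemma smooth_at_cinv q p : cdom (chart_ q) p ->
  smooth_at A (cinv (chart_ q)) (cmap (chart_ q) p).
Proof.
move=> qp; apply: (@germ_smooth_at _ _ _ q).
- by apply: cinv_continuous; exists p.
- by rewrite cmapK.
- apply: (@germ_ext _ _ _ (fun z => z)); last exact: germ_id.
  by have := near_cimg qp; apply: filterS => z /= /cimgK.
Qed.

Lemma smooth_at_cst V (p : M) (x : V) : smooth_at A (fun=> p) x.
Proof.
apply: (@germ_smooth_at _ _ _ p); [exact: cst_continuous|exact: chartAt_dom|].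
exact: germ_cst.
Qed.

Lemma smooth_at_local V (f : V -> M) x q : smooth_at A f x ->
  cdom (chart_ q) (f x) ->
  \near x, f x = cinv (chart_ q) ((cmap (chart_ q) \o f) x).
Proof.
by move=> sf qx; have := near_cdom sf.1 qx; apply: filterS => y qy /=; rewrite cmapK.
Qed.

Lemma smooth_at_near V (f : V -> M) x :
  smooth_at A f x -> \near x, smooth_at A f x.
Proof.
move=> sf; have dx := chartAt_dom A (f x).
have gn := germ_near (smooth_at_germ sf dx).
have ln := smooth_at_local sf dx; have dn := near_cdom sf.1 dx.
have /near_join lln := ln.
apply: filterS3 gn lln dn => y gy ly dy.
apply: smooth_at_ext
  (_ : smooth_at A (cinv (chart_ (f x)) \o (cmap (chart_ (f x)) \o f)) y).
  by apply: filterS ly => z /= <-.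
exact: smooth_at_comp (has_coords_rV _ _) gy (smooth_at_cinv dy).
Qed.

(** The differential [T_x V -> T_(f x) M] of a map into a manifold. *)
Definition tangent V (f : V -> M) (x : V) : V -> E := 'd (cmap (chart_ (f x)) \o f) x.

Definition smooth_map (F : M -> M) (p : M) :=
  smooth_at A (F \o cinv (chart_ p)) (cmap (chart_ p) p).

Lemma smooth_map_comp V (f : V -> M) (F : M -> M) x :
  smooth_at A f x -> smooth_map F (f x) -> smooth_at A (F \o f) x.
Proof.
move=> sf sF; have dx := chartAt_dom A (f x).
apply: smooth_at_ext (_ : smooth_at A
  ((F \o cinv (chart_ (f x))) \o (cmap (chart_ (f x)) \o f)) x).
  by have := smooth_at_local sf dx; apply: filterS => y /= <-.
exact: smooth_at_comp (has_coords_rV _ _) (smooth_at_germ sf dx) sF.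
Qed.

(** Any chart around [f x] computes the differential, up to the change from its
    coordinates to the preferred ones. *)
Lemma tangent_chart V (f : V -> M) x q : smooth_at A f x -> cdom (chart_ q) (f x) ->
  tangent f x = 'd (cmap (chart_ (f x)) \o cinv (chart_ q)) (cmap (chart_ q) (f x))
    \o 'd (cmap (chart_ q) \o f) x.
Proof.
move=> sf qx; have dx := chartAt_dom A (f x); rewrite /tangent.
apply: diff_factor.
- by have := smooth_at_local sf qx; apply: filterS => y /= <-.
- exact: germ_diff (smooth_at_germ sf qx).
- exact: germ_diff (germ_transition qx dx).
Qed.

Lemma tangent_comp V (f : V -> M) (F : M -> M) x :
  smooth_at A f x -> smooth_map F (f x) ->
  tangent (F \o f) x =
  'd (cmap (chart_ (F (f x))) \o F \o cinv (chart_ (f x))) (cmap (chart_ (f x)) (f x))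
    \o tangent f x.
Proof.
move=> sf sF; have dx := chartAt_dom A (f x); rewrite /tangent.
apply: diff_factor.
- by have := smooth_at_local sf dx; apply: filterS => y /= <-.
- exact: germ_diff (smooth_at_germ sf dx).
- have Fx : (F \o cinv (chart_ (f x))) (cmap (chart_ (f x)) (f x)) = F (f x).
    by rewrite /= cmapK.
  have dF := chartAt_dom A (F (f x)); rewrite -[in X in cdom _ X]Fx in dF.
  exact: germ_diff (smooth_at_germ sF dF).
Qed.

End Manifold.

Section LieCalculus.
Variables (R : realType) (n : nat) (G : lieGroup R n).
Implicit Types (V W : normedModType R) (p q h : G).
Local Notation E := 'rV[R]_n.
Local Notation A := (atlas G).
Local Notation chart_ p := (chartAt (atlas G) p).

(** Multiplication is smooth in product charts, and near [x] the product of [f]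
    and [g] is its composite with the pair of their local expressions. *)
Lemma smooth_at_mul V (f g : V -> G) x : smooth_at A f x -> smooth_at A g x ->
  smooth_at A (fun y => f y * g y)%g x.
Proof.
move=> sf sg; have fx := chartAt_dom A (f x); have gx := chartAt_dom A (g x).
pose u y := ((cmap (chart_ (f x)) \o f) y, (cmap (chart_ (g x)) \o g) y).
apply: smooth_at_ext (_ : smooth_at A ((fun z : E * E =>
  (cinv (chart_ (f x)) z.1 * cinv (chart_ (g x)) z.2)%g) \o u) x).
  have := smooth_at_local sf fx; have := smooth_at_local sg gx.
  by apply: filterS2 => y /= <- <-.
apply: smooth_at_comp (lie_mul_smooth _ _).
  by apply: has_coords_prod; exact: has_coords_rV.
by apply: germ_pair; exact: smooth_at_germ.
Qed.

Lemma smooth_at_inv V (f : V -> G) x : smooth_at A f x ->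
  smooth_at A (fun y => (f y)^-1)%g x.
Proof.
move=> sf; have fx := chartAt_dom A (f x).
apply: smooth_at_ext (_ : smooth_at A ((fun z : E =>
  ((cinv (chart_ (f x)) z)^-1)%g) \o (cmap (chart_ (f x)) \o f)) x).
  by have := smooth_at_local sf fx; apply: filterS => y /= <-.
apply: smooth_at_comp (lie_inv_smooth _); first exact: has_coords_rV.
exact: smooth_at_germ.
Qed.

Lemma smooth_at_cinv1 p : smooth_at A (cinv (chart_ p)) (cmap (chart_ p) p).
Proof. exact/smooth_at_cinv/chartAt_dom. Qed.

Lemma smooth_lmul h p : smooth_map A (fun q => h * q)%g p.
Proof. by apply: smooth_at_mul; [exact: smooth_at_cst|exact: smooth_at_cinv1]. Qed.

Lemma smooth_conj h p : smooth_map A (fun q => h * q * h^-1)%g p.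
Proof.
apply: smooth_at_mul; last exact: smooth_at_cst.
exact: smooth_lmul.
Qed.

Lemma mdiff_tangent (F : G -> G) p :
  mdiff F p = tangent A (F \o cinv (chart_ p)) (cmap (chart_ p) p).
Proof. by rewrite /mdiff /tangent /= cmapK //; exact: chartAt_dom. Qed.

Lemma mdiff_comp (F F' : G -> G) p : smooth_map A F' p -> smooth_map A F (F' p) ->
  mdiff (F \o F') p = mdiff F (F' p) \o mdiff F' p.
Proof.
move=> sF' sF.
have Kp : (F' \o cinv (chart_ p)) (cmap (chart_ p) p) = F' p.
  by rewrite /= cmapK //; exact: chartAt_dom.
have sFK : smooth_map A F ((F' \o cinv (chart_ p)) (cmap (chart_ p) p)).
  by rewrite Kp.
apply: etrans (mdiff_tangent _ _) _; apply: etrans (tangent_comp sF' sFK) _.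
by rewrite Kp -mdiff_tangent.
Qed.

Lemma velocity_tangent (gamma : R -> G) t : smooth_at A gamma t ->
  velocity gamma t = tangent A gamma t 1.
Proof.
move=> sg; rewrite /velocity derive1E'//.
by apply/germ_diff/(smooth_at_germ sg); exact: chartAt_dom.
Qed.

Lemma velocity_comp (gamma : R -> G) (F : G -> G) t : smooth_at A gamma t ->
  smooth_map A F (gamma t) ->
  velocity (F \o gamma) t = mdiff F (gamma t) (velocity gamma t).
Proof.
move=> sg sF; rewrite !velocity_tangent //; last exact: smooth_map_comp.
by rewrite tangent_comp.
Qed.

Lemma velocity_chart (gamma : R -> G) t q : smooth_at A gamma t ->
  cdom (chart_ q) (gamma t) ->
  velocity gamma t = from_chart (chart_ q) (gamma t)
    (derive1 (cmap (chart_ q) \o gamma) t).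
Proof.
move=> sg qt; rewrite velocity_tangent // (tangent_chart sg qt) /=.
rewrite /from_chart derive1E' //.
exact/germ_diff/smooth_at_germ.
Qed.

End LieCalculus.

(** * Partial derivatives *)

Section Slices.
Variable R : realType.
Implicit Types (V W X : normedModType R).

Lemma derive_coordf V n (f : V -> 'rV[R]_n) (x v : V) j : differentiable f x ->
  'D_v (coordf j \o f) x = coordf j ('D_v f x).
Proof.
move=> df; have dc : differentiable (coordf j) (f x).
  by apply: linear_differentiable; exact: coordf_cont.
rewrite deriveE; last exact: differentiable_comp.
by rewrite diff_comp //= diff_lin ?deriveE //; exact: coordf_cont.
Qed.

Lemma schwarz_rV V n (f : V -> 'rV[R]_n) (x v w : V) : smooth_germ f x ->
  'D_v ('D_w f) x = 'D_w ('D_v f) x.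
Proof.
move=> sf; apply/rowP => j.
have E (a b : V) : ('D_a ('D_b f) x) ord0 j = 'D_a ('D_b (coordf j \o f)) x.
  rewrite -[LHS]/(coordf j _) -derive_coordf; last exact/germ_diff/germ_derive.
  apply: near_eq_derive; apply: filterS (germ_near sf) => y sy.
  by rewrite derive_coordf //; exact: germ_diff.
apply: etrans (E v w) _; apply: etrans _ (esym (E w v)); apply: schwarz.
by apply: germ_comp (has_coords_rV _ _) sf _; apply: germ_lin; exact: coordf_cont.
Qed.

Lemma germ_slicel V W (b : W) (a : V) : smooth_germ (fun z => (z, b)) a.
Proof. by apply: germ_pair; [exact: germ_id|exact: germ_cst]. Qed.

Lemma germ_slicer V W (a : V) (b : W) : smooth_germ (fun w => (a, w)) b.
Proof. by apply: germ_pair; [exact: germ_cst|exact: germ_id]. Qed.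

Lemma is_diff_slicel V W (b : W) (a : V) :
  is_diff a (fun z : V => (z, b)) (fun v => (v, 0)).
Proof. exact: (@is_diff_pair _ _ _ _ id id (fun=> b) (fun=> 0)). Qed.

Lemma is_diff_slicer V W (a : V) (b : W) :
  is_diff b (fun w : W => (a, w)) (fun v => (0, v)).
Proof. exact: (@is_diff_pair _ _ _ _ (fun=> a) (fun=> 0) id id). Qed.

Lemma diff_slicel V W X (f : V * W -> X) a b : differentiable f (a, b) ->
  forall v, 'd (fun z => f (z, b)) a v = 'D_(v, 0) f (a, b).
Proof.
move=> df v; rewrite deriveE //; have [dl El] := is_diff_slicel b a.
by have -> := diff_comp dl df; rewrite /= El.
Qed.

Lemma diff_slicer V W X (f : V * W -> X) a b : differentiable f (a, b) ->
  forall w, 'd (fun z => f (a, z)) b w = 'D_(0, w) f (a, b).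
Proof.
move=> df v; rewrite deriveE //; have [dl El] := is_diff_slicer a b.
by have -> := diff_comp dl df; rewrite /= El.
Qed.

Lemma derive_slicel V W X (f : V * W -> X) a b v : smooth_germ f (a, b) ->
  'D_v (fun z => f (z, b)) a = 'D_(v, 0) f (a, b).
Proof.
move=> /germ_diff df; rewrite deriveE ?diff_slicel //.
by have [dl _] := is_diff_slicel b a; exact: differentiable_comp dl df.
Qed.

Lemma derive_slicer V W X (f : V * W -> X) a b v : smooth_germ f (a, b) ->
  'D_v (fun z => f (a, z)) b = 'D_(0, v) f (a, b).
Proof.
move=> /germ_diff df; rewrite deriveE ?diff_slicer //.
by have [dl _] := is_diff_slicer a b; exact: differentiable_comp dl df.
Qed.

Lemma is_diff_fst V W (p : V * W) :
  is_diff p (fun z : V * W => z.1) (fun z => z.1).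
Proof.
apply: DiffDef; first exact: germ_diff (germ_fst _).
by apply: (@diff_lin _ _ _ fst p) => q; exact: cvg_fst.
Qed.

Lemma row_sum_delta_pair n W (y : 'rV[R]_n) :
  (y, 0) = \sum_j y ord0 j *: (delta_mx ord0 j, 0) :> 'rV[R]_n * W.
Proof.
rewrite [RHS]surjective_pairing !raddf_sum /= -row_sum_delta.
by rewrite big1 // => j _; rewrite scaler0.
Qed.

Lemma derive_combination V W n (a : V -> 'rV[R]_n) (F : 'I_n -> V -> W) x v :
  differentiable a x -> (forall j, differentiable (F j) x) ->
  'D_v (fun z => \sum_j a z ord0 j *: F j z) x =
  \sum_j ('D_v a x ord0 j *: F j x + a x ord0 j *: 'D_v (F j) x).
Proof.
move=> da dF.
have dc j : differentiable (coordf j \o a) x.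
  apply: differentiable_comp => //; apply: linear_differentiable; exact: coordf_cont.
have H j := is_diff_scale (dc j) (dF j).
rewrite (_ : (fun _ => _) = \sum_j (fun z => (coordf j \o a) z *: F j z)); last first.
  by apply/funext => z; rewrite fct_sumE.
rewrite derive_sum; last by move=> j; exact/diff_derivable/(@ex_diff _ _ _ _ _ _ _ (H j)).
apply: eq_bigr => j _; rewrite deriveE; last exact: (@ex_diff _ _ _ _ _ _ _ (H j)).
rewrite (@diff_val _ _ _ _ _ _ _ (H j)) addrC -!deriveE // derive_coordf //.
Qed.
End Slices.

(** * The adjoint representation and its derivative at the identity *)

Section Adjoint.
Variables (R : realType) (n : nat) (G : lieGroup R n).
Implicit Types (p q h : G).
Local Notation E := 'rV[R]_n.
Local Notation A := (atlas G).
Local Notation chart_ p := (chartAt (atlas G) p).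
Local Notation c1 := (chartAt (atlas G) 1%g).
Local Notation e1 := (cmap (chartAt (atlas G) 1%g) 1%g).

Lemma mdiff_id p (v : E) : mdiff (id : G -> G) p v = v.
Proof.
have dp := chartAt_dom A p; rewrite /mdiff.
rewrite -(@near_eq_diff _ _ _ (fun z => z)).
- by rewrite (@diff_val _ _ _ _ _ _ _ (is_diff_id _)).
- by have := near_cimg dp; apply: filterS => z /= /cimgK.
- exact: germ_diff (germ_id _).
Qed.

Lemma conj1 h : (h * 1 * h^-1 = 1)%g.
Proof. by rewrite mulg1 mulgV. Qed.

Lemma Ad_one (v : E) : Ad (1%g : G) v = v.
Proof.
rewrite /Ad (_ : (fun q : G => 1 * q * 1^-1)%g = id) ?mdiff_id//.
by apply/funext => q; rewrite mul1g invg1 mulg1.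
Qed.

Lemma Ad_mul p q (v : E) : Ad (p * q)%g v = Ad p (Ad q v).
Proof.
rewrite /Ad (_ : (fun r : G => p * q * r * (p * q)^-1)%g =
  (fun r => p * r * p^-1)%g \o (fun r => q * r * q^-1)%g); last first.
  by apply/funext => r /=; rewrite invgM !mulgA.
rewrite mdiff_comp; [|exact: smooth_conj|exact: smooth_conj].
by rewrite /= conj1.
Qed.

(** The matrix acts on row vectors from the right, so products are reversed in
    [AdM_mul]. *)
Definition AdM p : 'M[R]_n := lin1_mx (Ad p).

Lemma AdME p (v : E) : v *m AdM p = Ad p v.
Proof. by rewrite /AdM /Ad /mdiff mul_rV_lin1. Qed.

Lemma AdM_entry p i j : AdM p i j = Ad p (delta_mx ord0 i) ord0 j.
Proof. by rewrite mxE. Qed.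
Opaque AdM.

Lemma AdM_one : AdM 1%g = 1%:M.
Proof.
apply/row_matrixP => i; rewrite !rowE AdME Ad_one mulmx1 //.
Qed.

Lemma AdM_mul p q : AdM (p * q)%g = AdM q *m AdM p.
Proof.
have H (v : E) : v *m AdM (p * q)%g = v *m (AdM q *m AdM p).
  rewrite mulmxA; apply: etrans (AdME (p * q)%g v) _.
  have -> := AdME p (v *m AdM q); have -> := AdME q v; exact: Ad_mul.
apply/row_matrixP => i.
by have := H (delta_mx ord0 i); rewrite -!rowE.
Qed.

Definition chart_mul (z : E * E) : E := cmap c1 (cinv c1 z.1 * cinv c1 z.2)%g.
Definition chart_conj (z : E * E) : E :=
  cmap c1 (cinv c1 z.1 * cinv c1 z.2 * (cinv c1 z.1)^-1)%g.

Lemma dom1 : cdom c1 (1%g : G).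
Proof. exact: chartAt_dom. Qed.

Lemma cinv1 : cinv c1 e1 = 1%g :> G.
Proof. by rewrite cmapK //; exact: dom1. Qed.

Let sm1 : smooth_at A (fun z : E * E => cinv c1 z.1) (e1, e1).
Proof.
apply: smooth_at_comp (has_coords_rV _ _) (germ_fst _) _ => /=.
exact: smooth_at_cinv dom1.
Qed.

Let sm2 : smooth_at A (fun z : E * E => cinv c1 z.2) (e1, e1).
Proof.
apply: smooth_at_comp (has_coords_rV _ _) (germ_snd _) _ => /=.
exact: smooth_at_cinv dom1.
Qed.

Lemma germ_chart_mul : smooth_germ chart_mul (e1, e1).
Proof.
apply: smooth_at_germ (smooth_at_mul sm1 sm2) _.
by rewrite /= cinv1 mulg1; exact: dom1.
Qed.

Lemma germ_chart_conj : smooth_germ chart_conj (e1, e1).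
Proof.
apply: smooth_at_germ (smooth_at_mul (smooth_at_mul sm1 sm2) (smooth_at_inv sm1)) _.
by rewrite /= cinv1 conj1; exact: dom1.
Qed.

Let near_l (P : E * E -> Prop) : (\forall z \near (e1, e1), P z) ->
  \forall z \near e1, P (z, e1).
Proof.
move=> nP; have := germ_cont (germ_slicel (e1 : E) (e1 : E)); exact.
Qed.

Let near_r (P : E * E -> Prop) : (\forall z \near (e1, e1), P z) ->
  \forall z \near e1, P (e1, z).
Proof.
move=> nP; have := germ_cont (germ_slicer (e1 : E) (e1 : E)); exact.
Qed.

Lemma Ad_chart (y : E) :
  \forall z \near e1, Ad (cinv c1 z) y = 'D_(0, y) chart_conj (z, e1).
Proof.
apply: filterS (near_l (germ_near germ_chart_conj)) => z sz.
rewrite -diff_slicer; last exact: germ_diff.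
by rewrite /Ad /mdiff conj1.
Qed.

Lemma germ_Ad (y : E) : smooth_germ (fun z => Ad (cinv c1 z) y) e1.
Proof.
apply: (@germ_ext _ _ _ ('D_(0, y) chart_conj \o (fun z => (z, e1)))).
  by apply: filterS (Ad_chart y) => z ->.
apply: germ_comp (germ_slicel _ _) (germ_derive _ germ_chart_conj).
by apply: has_coords_prod; exact: has_coords_rV.
Qed.

(** The change of coordinates from the preferred chart at [q = cinv c1 z] to the
    chart at the identity composes with the differential of left translation by
    [q] to the differential of [w |-> chart_mul (z, w)]. *)
Lemma left_field_chart (y : E) :
  \forall z \near e1, field_in_chart c1 (left_field y) z = 'D_(0, y) chart_mul (z, e1).
Proof.
apply: filterS2 (near_l (germ_near germ_chart_mul)) (near_cimg dom1) => z sz zc.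
rewrite -diff_slicer; last exact: germ_diff.
rewrite /field_in_chart /to_chart /left_field /mdiff mulg1.
set q := cinv c1 z.
have dq : cdom c1 q by exact: cimg_dom.
have dqq := chartAt_dom A q.
have sq : smooth_at A ((fun r => q * r)%g \o cinv c1) e1 := smooth_lmul q 1%g.
have Eq : ((fun r => q * r)%g \o cinv c1) e1 = q by rewrite /= cinv1 mulg1.
have dqE : cdom (chart_ q) (((fun r => q * r)%g \o cinv c1) e1) by rewrite Eq.
pose u : E -> E := cmap (chart_ q) \o ((fun r => q * r)%g \o cinv c1).
have Eu : u e1 = cmap (chart_ q) q by rewrite /u /= cinv1 mulg1.
have du : differentiable u e1 := germ_diff (smooth_at_germ sq dqE).
have dt : differentiable (cmap c1 \o cinv (chart_ q)) (u e1).
  by rewrite Eu; exact: germ_diff (germ_transition dqq dq).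
have nE : \forall w \near e1, chart_mul (z, w) = (cmap c1 \o cinv (chart_ q)) (u w).
  by have := smooth_at_local sq dqE; apply: filterS => w /= Ew; rewrite /u /= -Ew.
have H := diff_factor nE du dt.
rewrite Eu in H.
exact: esym (congr1 (fun f => f y) H).
Qed.

Lemma left_field1 (x : E) : left_field x (1%g : G) = x.
Proof.
rewrite /left_field (_ : (fun q : G => 1 * q)%g = id) ?mdiff_id //.
by apply/funext => q; rewrite mul1g.
Qed.

Lemma ad_chart_mul (x y : E) : ad G x y =
  'D_(x, 0) ('D_(0, y) chart_mul) (e1, e1) - 'D_(y, 0) ('D_(0, x) chart_mul) (e1, e1).
Proof.
rewrite /ad /field_bracket !left_field1; congr (_ - _).
- rewrite (near_eq_derive _ (left_field_chart y)).
  rewrite (@derive_slicel _ _ _ _ ('D_(0, y) chart_mul)) //.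
  exact: germ_derive germ_chart_mul.
- rewrite (near_eq_derive _ (left_field_chart x)).
  rewrite (@derive_slicel _ _ _ _ ('D_(0, x) chart_mul)) //.
  exact: germ_derive germ_chart_mul.
Qed.

(** This is [c q = (c q c^-1) c], which avoids inverses when differentiating. *)
Lemma chart_mul_conj : \forall z \near (e1, e1),
  chart_mul z = chart_mul (chart_conj z, z.1).
Proof.
have s := smooth_at_mul (smooth_at_mul sm1 sm2) (smooth_at_inv sm1).
have d : cdom c1 (cinv c1 (e1, e1).1 * cinv c1 (e1, e1).2 * (cinv c1 (e1, e1).1)^-1)%g.
  by rewrite /= cinv1 conj1; exact: dom1.
apply: filterS (smooth_at_local s d) => z; rewrite /chart_mul /chart_conj /= => <-.
by rewrite -!mulgA mulVg mulg1.
Qed.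

Lemma chart_mul1 : \forall z \near e1, chart_mul (z, e1) = z.
Proof.
apply: filterS (near_cimg dom1) => z zc.
by rewrite /chart_mul /= cinv1 mulg1 cimgK.
Qed.

Lemma chart_conj1 (z : E) : chart_conj (z, e1) = e1.
Proof. by rewrite /chart_conj /= cinv1 conj1. Qed.

Lemma derive_chart_mul1 (v : E) : 'D_(v, 0) chart_mul (e1, e1) = v.
Proof.
rewrite -derive_slicel; last exact: germ_chart_mul.
by rewrite (near_eq_derive _ chart_mul1) derive_id.
Qed.

(** [chart_mul_conj] differentiated in the second argument: conjugation
    fixes the identity, so the right-hand side is a derivative of multiplication
    in its first argument, along the moving direction [Ad c y]. *)
Lemma derive_chart_mul_conj (y : E) : \forall z \near e1,
  'D_(0, y) chart_mul (z, e1) =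
  \sum_j Ad (cinv c1 z) y ord0 j *: 'D_(delta_mx ord0 j, 0) chart_mul (e1, z).
Proof.
have /near_join/near_l nE := chart_mul_conj.
apply: filterS3 (filterI nE (Ad_chart y)) (near_l (germ_near germ_chart_mul))
  (filterI (near_l (germ_near germ_chart_conj)) (near_r (germ_near germ_chart_mul))).
move=> z [Ez Az] sz [cz rz]; rewrite Az (near_eq_derive _ Ez).
have dc := germ_diff cz; have dm := germ_diff rz.
pose u (p : E * E) := (chart_conj p, p.1).
have [du Edu] : is_diff (z, e1) u (fun v => ('d chart_conj (z, e1) v, v.1)).
  exact: is_diff_pair (differentiableP dc) (is_diff_fst _).
have Eu : u (z, e1) = (e1, z) by rewrite /u chart_conj1.
have dmu : differentiable chart_mul (u (z, e1)) by rewrite Eu.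
have H := diff_comp du dmu; rewrite Edu Eu in H.
have Ea : 'd chart_conj (z, e1) (0, y) = 'D_(0, y) chart_conj (z, e1) by rewrite deriveE.
have dc' : differentiable (chart_mul \o u) (z, e1) := differentiable_comp du dmu.
apply: etrans (deriveE (0, y) dc') _.
apply: etrans (congr1 (fun f => f (0, y)) H) _.
have Es : ('d chart_conj (z, e1) (0, y), 0) = _ :> E * E :=
  etrans (congr1 (fun v => (v, 0) : E * E) Ea) (row_sum_delta_pair E _).
apply: etrans (congr1 ('d chart_mul (e1, z)) Es) _.
rewrite linear_sum; apply: eq_bigr => j _.
rewrite linearZ /=; congr (_ *: _); exact: esym (deriveE (delta_mx ord0 j, 0) dm).
Qed.

(** The derivative of [Ad] at the identity is [ad]. Differentiating
    [c q = (c q c^-1) c] in [q] and then in [c] produces the mixed derivatives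
    of the multiplication in the order opposite to the one in the bracket of
    left-invariant fields; their symmetry identifies the two. *)
Lemma derive_Ad (x y : E) :
  'D_x (fun z => Ad (cinv c1 z) y) e1 = ad G x y.
Proof.
have sF j : smooth_germ (fun z => 'D_(delta_mx ord0 j, 0) chart_mul (e1, z)) e1.
  apply: (@germ_comp _ _ _ _ (fun z => (e1, z)) ('D_(delta_mx ord0 j, 0) chart_mul)).
  - by apply: has_coords_prod; exact: has_coords_rV.
  - exact: germ_slicer.
  - exact: germ_derive germ_chart_mul.
have H := near_eq_derive x (derive_chart_mul_conj y).
rewrite (@derive_slicel _ _ _ _ ('D_(0, y) chart_mul)) in H; last first.
  exact: germ_derive germ_chart_mul.
have D := derive_combination x (germ_diff (germ_Ad y)) (fun j => germ_diff (sF j)).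
rewrite ad_chart_mul; apply/esym; apply: etrans (congr1 (+%R^~ _) (etrans H D)) _.
rewrite big_split /= cinv1 Ad_one.
under eq_bigr do rewrite derive_chart_mul1.
rewrite -row_sum_delta; apply/eqP; rewrite subr_eq; apply/eqP; congr (_ + _).
under eq_bigr => j _.
  rewrite (@derive_slicer _ _ _ _ ('D_(delta_mx ord0 j, 0) chart_mul)); last first.
    exact: germ_derive germ_chart_mul.
  rewrite schwarz_rV; last exact: germ_chart_mul.
  rewrite deriveE; last exact: germ_diff (germ_derive _ germ_chart_mul).
  over.
rewrite deriveE; last exact: germ_diff (germ_derive _ germ_chart_mul).
rewrite [X in _ = 'd _ _ X]row_sum_delta_pair.
by rewrite linear_sum; apply: eq_bigr => j _; rewrite linearZ.
Qed.

Lemma germ_AdM i j : smooth_germ (fun z => AdM (cinv c1 z) i j) e1.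
Proof.
apply: (@germ_ext _ _ _ (coordf j \o (fun z => Ad (cinv c1 z) (delta_mx ord0 i)))).
  by near=> z; rewrite /= AdM_entry.
apply: germ_comp (has_coords_rV _ _) (germ_Ad _) _.
by apply: germ_lin; exact: coordf_cont.
Unshelve. all: by end_near. Qed.

Lemma derive_AdM (x : E) i j :
  'D_x (fun z => AdM (cinv c1 z) i j) e1 = lin1_mx (ad G x) i j.
Proof.
rewrite mxE -derive_Ad -[RHS]/(coordf j _) -derive_coordf; last first.
  exact: germ_diff (germ_Ad _).
by apply: near_eq_derive; near=> z; rewrite /= AdM_entry.
Unshelve. all: by end_near. Qed.
End Adjoint.

(** * A smooth step *)

Section FlatStep.
Variable R : realType.
Implicit Types (P : {poly R}) (x y : R).

(** Each monomial [y ^ k] is at most [k! exp y], by the exponential series. *)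
Lemma exp_poly_bound P : exists2 C, 0 <= C &
  forall y, 0 <= y -> `|P.[y]| <= C * expR y.
Proof.
exists (\sum_(i < size P) `|P`_i| * i`!%:R).
  by apply: sumr_ge0 => i _; rewrite mulr_ge0.
move=> y y0; rewrite horner_coef mulr_suml.
apply: le_trans (ler_norm_sum _ _ _) _; apply: ler_sum => i _.
rewrite normrM -mulrA ler_wpM2l // ger0_norm ?exprn_ge0 //.
case: (i : nat) => [|k]; first by rewrite expr0 fact0 mul1r -expR0 ler_expR.
rewrite mulrC -ler_pdivrMr ?ltr0n ?fact_gt0 //.
by apply: le_trans (expR_ge1Dxn k y0); rewrite lerDr.
Qed.

(** The functions [P(1/x) exp(-1/x)], extended by zero to [x <= 0]; as [P]
    varies they form a family closed under derivation. *)
Definition flat P x : R := if 0 < x then P.[x^-1] * expR (- x^-1) else 0.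

Definition flat_deriv P : {poly R} := 'X^2 * (P - P^`()).

Lemma flat_bound P : exists C, forall x, `|flat P x| <= C * `|x|.
Proof.
have [C C0 HC] := exp_poly_bound (P * 'X); exists C => x.
rewrite /flat; case: ifPn => [x0|_]; last by rewrite normr0 mulr_ge0.
have x0' : 0 < x^-1 by rewrite invr_gt0.
have := HC _ (ltW x0'); rewrite hornerMX normrM (gtr0_norm x0') (gtr0_norm x0).
rewrite ler_pdivrMr // => H; rewrite normrM (gtr0_norm (expR_gt0 _)) expRN.
by rewrite ler_pdivrMr ?expR_gt0 // mulrAC.
Qed.

Lemma flatMX P x : x != 0 -> flat (P * 'X) x = x^-1 * flat P x.
Proof.
by move=> x0; rewrite /flat; case: ifP => _; rewrite ?mulr0 // hornerMX mulrAC mulrC.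
Qed.

(** The difference quotient of [P(1/x) exp(-1/x)] at [0] is [Q(1/x) exp(-1/x)]
    with [Q = P X], and every such function tends to [0]. *)
Lemma is_derive_flat0 P : is_derive (0 : R) 1 (flat P) 0.
Proof.
have [C HC] := flat_bound (P * 'X).
have F0 : flat P 0 = 0 by rewrite /flat ltxx.
have cv : (fun h => h^-1 *: ((flat P \o shift 0) (h *: 1) - flat P 0)) @ 0^' --> (0 : R).
  apply/cvgr0Pnorm_le => e e0; near=> h.
  have h0 : h != 0 by near: h; exact: nbhs_dnbhs_neq.
  rewrite /= F0 subr0 addr0 [h *: 1]mulr1 -[_ *: _]/(h^-1 * flat P h) -flatMX //.
  have C1 : 0 < `|C| + 1 by rewrite ltr_wpDl.
  have he : `|h| <= e / (`|C| + 1).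
    by near: h; apply: dnbhs0_le; rewrite divr_gt0.
  apply: le_trans (HC h) _; rewrite ler_pdivlMr // in he.
  apply: le_trans he; rewrite mulrC ler_wpM2l //.
  by apply: le_trans (ler_norm _) _; rewrite lerDl.
by apply: DeriveDef; [apply/cvg_ex; exists 0|exact/cvg_lim].
Unshelve. all: by end_near. Qed.

Lemma is_derive_flat P x : is_derive x (1 : R) (flat P) (flat (flat_deriv P) x).
Proof.
have [x0|x0|->] := ltgtP x 0.
- have -> : flat (flat_deriv P) x = 0 by rewrite /flat ltNge (ltW x0).
  apply: (near_eq_is_derive _ (is_derive_cst (0 : R) x 1)).
  have := lt_nbhsl x0; apply: filterS => y y0.
  by rewrite /flat ltNge (ltW y0).
- have -> : flat (flat_deriv P) x = (flat_deriv P).[x^-1] * expR (- x^-1).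
    by rewrite /flat x0.
  have xn : x != 0 by rewrite gt_eqF.
  pose g (y : R) := P.[y] * expR (- y).
  have nE : \near x, (g \o (fun z => z^-1)) x = flat P x.
    by have := lt_nbhsr x0; apply: filterS => y y0; rewrite /flat y0.
  have dg : is_derive x^-1 (1 : R) g ((P^`() - P).[x^-1] * expR (- x^-1)).
    have de : is_derive x^-1 (1 : R) (expR \o -%R) (expR (- x^-1) * -1).
      exact: is_derive1_comp.
    have := is_deriveM (is_derive_poly P x^-1) de.
    move=> /is_derive_eq; apply; rewrite /= !hornerE /GRing.scale /=.
    by rewrite mulrBl mulrN1 mulrN addrC [_ * P^`().[_]]mulrC.
  have di : is_derive x (1 : R) (fun z : R => z^-1) (- x ^- 2).
    apply: DeriveDef; first exact: derivableV.
    by rewrite deriveV // derive_id /GRing.scale /= mulr1.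
  apply: is_derive_eq (near_eq_is_derive nE (is_derive1_comp dg di)) _.
   rewrite /flat_deriv !hornerE.
  rewrite exprVn; ring.
- have -> : flat (flat_deriv P) 0 = 0 by rewrite /flat ltxx.
  exact: is_derive_flat0.
Qed.

Lemma germ_flat P x : smooth_germ (flat P) x.
Proof.
exists setT; split=> [||k]; [exact: openT|by []|].
elim: k P => [|k IH] P.
  move=> y _; apply: differentiable_continuous; apply/derivable1_diffP.
  exact: (@ex_derive _ _ _ _ _ _ _ (is_derive_flat P y)).
have dP y : differentiable (flat P) y.
  apply/derivable1_diffP; exact: (@ex_derive _ _ _ _ _ _ _ (is_derive_flat P y)).
split=> [y _|v]; first exact: dP.
rewrite (_ : 'D_v (flat P) = flat (v *: flat_deriv P)) //.
apply/funext => y; rewrite deriveE // -[v in LHS]mulr1 linearZ /= -deriveE //.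
rewrite (@derive_val _ _ _ _ _ _ _ (is_derive_flat P y)) /flat.
by case: ifP => _; rewrite ?scaler0 // hornerZ -mulrA.
Qed.

Lemma flat1_ge0 x : 0 <= flat 1 x.
Proof. by rewrite /flat; case: ifP => // _; rewrite hornerC mul1r expR_ge0. Qed.

Lemma flat1_le x y : x <= y -> flat 1 x <= flat 1 y.
Proof.
move=> xy; rewrite [in leLHS]/flat; case: ifPn => [x0|_]; last exact: flat1_ge0.
have y0 := lt_le_trans x0 xy.
by rewrite /flat y0 !hornerC !mul1r ler_expR lerN2 lef_pV2.
Qed.

Lemma flat1_gt0 x : 0 < x -> 0 < flat 1 x.
Proof. by move=> x0; rewrite /flat x0 hornerC mul1r expR_gt0. Qed.

(** With [f] the flat function, [f (f 1 - f x)] is constant for [x <= 0] and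
    vanishes for [x >= 1], so an affine image of it is a smooth step. *)
Lemma smooth_step : exists phi : R -> R, [/\ forall x, smooth_germ phi x,
  forall x, x <= 0 -> phi x = 0, forall x, 1 <= x -> phi x = 1 &
  forall x, 0 <= phi x <= 1].
Proof.
pose f := flat 1; pose v x := f (f 1 - f x).
have f0 x : x <= 0 -> f x = 0 by rewrite /f /flat leNgt => /negbTE ->.
have v0 : 0 < v 0.
  by rewrite /v (f0 0) // subr0; apply/flat1_gt0/flat1_gt0.
exists (fun x => 1 - (v 0)^-1 * v x); split.
- move=> x; apply: germD; first exact: germ_cst.
  have gv : smooth_germ v x.
    apply: (@germ_comp _ _ _ _ (fun x => f 1 - f x) f) (has_coords_R _) _ (germ_flat _ _).
    apply: germD; first exact: germ_cst.
    rewrite (_ : (fun x => - f x) = (fun x => (-1) *: f x)); last first.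
      by apply/funext => y; rewrite scaleN1r.
    exact: (@germZ R R R (fun=> -1) f x (germ_cst _ _) (germ_flat _ _)).
  rewrite (_ : (fun x => - ((v 0)^-1 * v x)) = (fun x => (- (v 0)^-1) *: v x)).
  2: by apply/funext => y; rewrite -mulNr.
  exact: (@germZ R R R (fun=> - (v 0)^-1) v x (germ_cst _ _) gv).
- move=> x x0; have -> : v x = v 0 by rewrite /v (f0 x x0) (f0 0 (lexx 0)).
  by rewrite mulVf ?gt_eqF // subrr.
- move=> x x1; have -> : v x = 0 by rewrite /v f0 // subr_le0 flat1_le.
  by rewrite mulr0 subr0.
- move=> x; have vx0 : 0 <= v x by exact: flat1_ge0.
  have vx1 : v x <= v 0.
    by apply: flat1_le; rewrite (f0 0) // subr0 gerBl; exact: flat1_ge0.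
  move: (v x) (v 0) vx0 vx1 v0 => a b a0 ab b0.
  have ba0 : 0 <= b^-1 * a by rewrite mulr_ge0 // invr_ge0 ltW.
  have ba1 : b^-1 * a <= 1 by rewrite mulrC ler_pdivrMr // mul1r.
  by rewrite subr_ge0 ba1 gerBl ba0.
Qed.
End FlatStep.

(** * Eigenvalues near one *)

Section RootNearOne.
Variable C : numClosedFieldType.

(** The modulus of [p.[1]] is the product of the distances from [1] to the [n]
    roots, hence would be at least [2 ^- n] if they all exceeded 1/2. *)
Lemma root_near_one (p : {poly C}) n : p \is monic -> size p = n.+1 ->
  `|p.[1]| < 2^-1 ^+ n -> exists2 z, root p z & `|1 - z| <= 2^-1.
Proof.
move=> pm ps; have [r Ep] := closed_field_poly_normal p.
move: Ep; rewrite (monicP pm) scale1r => Ep.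
have rn : size r = n by move: ps; rewrite Ep size_prod_XsubC => -[].
move=> pn; have [/hasP[z zr zn]|/hasPn nr] := boolP (has (fun z => `|1 - z| <= 2^-1) r).
  by exists z => //; rewrite Ep root_prod_XsubC.
have h2 : (2^-1 : C) \is Num.real by rewrite ger0_real // invr_ge0.
exfalso; move: pn; apply/negP; rewrite -real_leNgt ?realX ?normr_real //.
rewrite Ep horner_prod normr_prod -rn.
elim: r nr {Ep rn} => [|z r IH] nr; first by rewrite big_nil expr0.
rewrite big_cons /= exprS ler_pM ?invr_ge0 ?exprn_ge0 //.
- rewrite hornerXsubC ltW // real_ltNge ?h2 ?normr_real //.
  by apply: nr; rewrite mem_head.
- by apply: IH => y yr; apply: nr; rewrite inE yr orbT.
Qed.

(** A matrix moving an eigenvector by a factor of modulus at least [r] keeps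
    expanding, even after composition with a matrix close to the identity:
    compare the [l^1]-norms of the eigenvector before and after. *)
Lemma eigen_growth n (N : nat -> 'M[C]_n) (B : 'M[C]_n) (w : 'cV[C]_n) (z r : C) :
  w != 0 -> B *m w = z *: w -> 0 <= r -> r <= `|z| ->
  (forall k, N k.+1 = N k *m B) ->
  (forall j, \sum_i `|N 0%N i j - (i == j)%:R| <= 2^-1) ->
  forall k, r ^+ k / 2 <= \sum_i \sum_j `|N k i j|.
Proof.
move=> w0 Bw r0 rz NS N0 k.
have Nw : N k *m w = z ^+ k *: (N 0%N *m w).
  elim: k => [|k IH]; first by rewrite expr0 scale1r.
  by rewrite NS -mulmxA Bw -scalemxAr IH scalerA -exprS.
pose S := \sum_j `|w j ord0|.
have S0 : 0 < S.
  rewrite lt0r sumr_ge0 // andbT; apply: contra w0.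
  rewrite psumr_eq0 // => /allP H; apply/eqP/colP => j; rewrite mxE.
  by apply/eqP; rewrite -normr_eq0; apply: H; rewrite mem_index_enum.
have lower : S / 2 <= \sum_i `|(N 0%N *m w) i ord0|.
  have -> : S / 2 = S - \sum_j 2^-1 * `|w j ord0|.
    by rewrite -mulr_sumr -/S; field.
  have H : \sum_i \sum_j `|N 0%N i j - (i == j)%:R| * `|w j ord0| <=
      \sum_j 2^-1 * `|w j ord0|.
    rewrite exchange_big /=; apply: ler_sum => j _.
    by rewrite -mulr_suml ler_wpM2r.
  apply: le_trans (lerB (lexx S) H) _; rewrite /S -sumrB; apply: ler_sum => i _.
  rewrite lerBlDr.
  have -> : w i ord0 = (N 0%N *m w) i ord0 - \sum_j (N 0%N i j - (i == j)%:R) * w j ord0.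
    under eq_bigr do rewrite mulrBl.
    rewrite sumrB mxE opprB addrC subrK (bigD1 i) //= eqxx mul1r big1 ?addr0 //.
    by move=> j; rewrite eq_sym => /negbTE ->; rewrite mul0r.
  apply: le_trans (ler_normB _ _) _; rewrite lerD2l.
  apply: le_trans (ler_norm_sum _ _ _) _.
  by apply: ler_sum => j _; rewrite normrM.
have upper : \sum_i `|(N k *m w) i ord0| <= (\sum_i \sum_j `|N k i j|) * S.
  rewrite mulr_suml; apply: ler_sum => i _; rewrite mxE mulr_suml.
  apply: le_trans (ler_norm_sum _ _ _) _; apply: ler_sum => j _.
  rewrite normrM ler_wpM2l // /S (bigD1 j) //= lerDl sumr_ge0 //.
rewrite -(ler_pM2r S0) -mulrA [_^-1 * S]mulrC; apply: le_trans upper.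
have -> : \sum_i `|(N k *m w) i ord0| = `|z| ^+ k * \sum_i `|(N 0%N *m w) i ord0|.
  by rewrite mulr_sumr; apply: eq_bigr => i _; rewrite Nw mxE normrM normrX.
apply: ler_pM => //; first exact: exprn_ge0.
  by rewrite divr_ge0 // ltW.
by rewrite lerXn2r ?nnegrE.
Qed.
End RootNearOne.

Section RealGrowth.
Variable R : realType.
Local Notation C := (complex R).
Local Notation inC := (real_complex R).

Lemma norm_inC (x : R) : `|inC x| = inC `|x|.
Proof. by rewrite normc_def /= expr0n addr0 sqrtr_sqr. Qed.

(** If [det (1 - B)] is small then [B] has a complex eigenvalue within 1/2 of
    [1], so [1 + e B] has one of real part at least [1 + e / 2]. Complex
    eigenvalues are used because a multiple real eigenvalue may leave the real
    line under perturbation. *)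
Lemma det_growth n (N : nat -> 'M[R]_n) (B : 'M[R]_n) (e : R) : 0 < e ->
  `|\det (1%:M - B)| < 2^-1 ^+ n ->
  (forall k, N k.+1 = N k *m (1%:M + e *: B)) ->
  (forall j, \sum_i `|N 0%N i j - (i == j)%:R| <= 2^-1) ->
  forall k, (1 + e / 2) ^+ k / 2 <= \sum_i \sum_j `|N k i j|.
Proof.
move=> e0 dB NS N0 k.
have [|||z zr z1] := @root_near_one C (char_poly (map_mx inC B^T)) n.
- exact: char_poly_monic.
- exact: size_char_poly.
- have -> : (char_poly (map_mx inC B^T)).[1] = inC (\det (1%:M - B)).
    rewrite -map_char_poly -[1 in LHS](rmorph1 inC) horner_map; congr (inC _).
    rewrite /char_poly -horner_evalE -det_map_mx -det_tr; congr (\det _).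
    apply/matrixP => i j; rewrite !mxE /= /horner_eval hornerD hornerN hornerMn.
    by rewrite hornerX hornerC eq_sym.
  rewrite norm_inC -[2]/(2%:R) -(rmorph_nat inC) -fmorphV -rmorphXn ltcR //.
move: zr; rewrite -eigenvalue_root_char => /eigenvalueP[v Ev v0].
pose w := v^T.
have Bw : map_mx inC (1%:M + e *: B) *m w = (1 + inC e * z) *: w.
  rewrite map_mxD map_mx1 map_mxZ mulmxDl mul1mx scalerDl scale1r; congr (_ + _).
  rewrite -scalemxAl -scalerA; congr (_ *: _); rewrite -[LHS]trmxK trmx_mul /w trmxK.
  by rewrite map_trmx Ev linearZ.
have w0 : w != 0 by rewrite /w trmx_eq0.
have rz : inC (1 + e / 2) <= `|1 + inC e * z|.
  apply: le_trans (normc_ge_Re _); rewrite lecR; apply: le_trans (ler_norm _).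
  case: z z1 {Ev Bw} => a b /= z1; rewrite mul0r subr0 lerD2l ler_pM2l //.
  have : inC `|1 - a| <= inC 2^-1.
    apply: le_trans (normc_ge_Re (1 - (a +i* b)%C)) _; apply: le_trans z1 _.
    by rewrite fmorphV rmorph_nat.
  by rewrite lecR ler_norml => /andP[_]; lra.
have r0 : 0 <= inC (1 + e / 2) by rewrite ler0c; lra.
have := @eigen_growth C n (fun k => map_mx inC (N k)) _ w _ _ w0 Bw r0 rz _ _ k.
have -> : inC (1 + e / 2) ^+ k / 2 = inC ((1 + e / 2) ^+ k / 2).
  by rewrite rmorphM rmorphXn fmorphV rmorph_nat.
have -> : \sum_i \sum_j `|map_mx inC (N k) i j| = inC (\sum_i \sum_j `|N k i j|).
  rewrite rmorph_sum; apply: eq_bigr => i _; rewrite rmorph_sum.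
  by apply: eq_bigr => j _; rewrite mxE norm_inC.
rewrite lecR; apply.
- by move=> m; rewrite NS map_mxM.
- move=> j; have -> : 2^-1 = inC 2^-1 by rewrite fmorphV rmorph_nat.
  have := N0 j; rewrite -lecR rmorph_sum; congr (_ <= _).
  by apply: eq_bigr => i _; rewrite mxE -(rmorph_nat inC (i == j)) -rmorphB norm_inC.
Qed.
End RealGrowth.

(** * A group element with expanding adjoint powers *)

Section EigenStep.
Variables (R : realType) (n : nat) (G : lieGroup R n).
Local Notation E := 'rV[R]_n.
Local Notation A := (atlas G).
Local Notation c1 := (chartAt (atlas G) 1%g).
Local Notation e1 := (cmap (chartAt (atlas G) 1%g) 1%g).

Lemma cvg_det (T : Type) (F : set_system T) (FF : Filter F) m
    (M : T -> 'M[R]_m) (D : 'M[R]_m) :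
  (forall i j, M t i j @[t --> F] --> D i j) -> \det (M t) @[t --> F] --> \det D.
Proof.
move=> MD; apply: (@cvg_big R _ +%R) => [|s _]; first exact: add_continuous.
apply: cvgMr; apply: (@cvg_big R _ *%R) => [|i _]; first exact: mul_continuous.
exact: MD.
Qed.

Lemma cvg_det_quotient m (N : R -> 'M[R]_m) (L : 'M[R]_m) (F : set_system R)
    (FF : Filter F) :
  (forall i j, s^-1 * (N s i j - (i == j)%:R) @[s --> F] --> L i j) ->
  \det (1%:M - s^-1 *: (N s - 1%:M)) @[s --> F] --> \det (1%:M - L).
Proof.
move=> NL; apply: cvg_det => i j; rewrite !mxE.
under eq_cvg do rewrite !mxE.
by apply: cvgB; [exact: cvg_cst|exact: NL].
Qed.

(** This curve has velocity [x] at the identity but need not be a one-parameter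
    subgroup. *)
Definition seg (x : E) (s : R) : G := cinv c1 (s *: x + e1).

Lemma seg0 x : seg x 0 = 1%g.
Proof. by rewrite /seg scale0r add0r cinv1. Qed.

Lemma cvg_seg x : (fun s : R => s *: x + e1) @ 0 --> e1.
Proof.
rewrite -[X in _ --> X]add0r -(scale0r x).
by apply: cvgD; [apply: cvgZr_tmp; exact: cvg_id|exact: cvg_cst].
Qed.

Lemma AdM_one_entry i j : AdM (1%g : G) i j = (i == j)%:R.
Proof. by rewrite AdM_one [LHS]mxE. Qed.

Lemma cvg_AdM_seg0 x i j :
  AdM (seg x s) i j @[s --> (0 : R)] --> ((i == j)%:R : R).
Proof.
have c := germ_cont (@germ_AdM _ _ G i j).
have -> : (i == j)%:R = AdM (cinv c1 e1) i j by rewrite cinv1 AdM_one_entry.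
exact: cvg_comp (@cvg_seg x) c.
Qed.

Lemma cvg_AdM_seg x i j :
  s^-1 * (AdM (seg x s) i j - (i == j)%:R) @[s --> 0^'] --> lin1_mx (ad G x) i j.
Proof.
have d := germ_diff (@germ_AdM _ _ G i j).
have : derivable (fun z => AdM (cinv c1 z) i j) e1 x by exact: diff_derivable.
move=> H; rewrite -derive_AdM; apply: cvg_trans H; apply: near_eq_cvg.
have E1 : AdM (cinv c1 e1) i j = (i == j)%:R by rewrite cinv1 AdM_one_entry.
by near=> s; rewrite -E1.
Unshelve. all: by end_near. Qed.

(** The quotients [(Ad (seg x e) - 1) / e] converge to [ad x], which has the
    eigenvalue [1]; so for small [e] their characteristic polynomials are small
    at [1]. *)
Lemma eigen_step (x : E) (lam : 'cV[R]_n) :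
  lam != 0 -> lin1_mx (ad G x) *m lam = lam ->
  exists e : R, [/\ 0 < e,
    forall s, 0 <= s <= e -> (cmap c1 @` cdom c1) (s *: x + e1),
    forall s, 0 <= s <= e -> forall j,
      \sum_i `|AdM (seg x s) i j - (i == j)%:R| <= 2^-1 &
    `|\det (1%:M - e^-1 *: (AdM (seg x e) - 1%:M))| < 2^-1 ^+ n].
Proof.
move=> l0 Dl.
have D0 : \det (1%:M - lin1_mx (ad G x)) = 0.
  rewrite -det_tr; apply/eqP/det0P; exists lam^T; first by rewrite trmx_eq0.
  by rewrite -trmx_mul mulmxBl mul1mx Dl subrr trmx0.
have N1 : \forall s \near (0 : R), (cmap c1 @` cdom c1) (s *: x + e1).
  by apply: (@cvg_seg x); exact: near_cimg (dom1 G).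
have N2 : \forall s \near (0 : R), forall j,
    \sum_i `|AdM (seg x s) i j - (i == j)%:R| <= 2^-1.
  suff H j : \forall s \near (0 : R), \sum_i `|AdM (seg x s) i j - (i == j)%:R| <= 2^-1.
    exact: filter_forall H.
  have c : \sum_i `|AdM (seg x s) i j - (i == j)%:R| @[s --> (0 : R)] --> (0 : R).
    have c0 i : `|AdM (seg x s) i j - (i == j)%:R| @[s --> (0 : R)] --> (0 : R).
      have := cvg_norm (cvgB (@cvg_AdM_seg0 x i j) (cvg_cst ((i == j)%:R : R))).
      by rewrite subrr normr0; exact.
    have Z : \sum_(i < n) (0 : R) = 0 by rewrite big1.
    rewrite -[X in _ --> X]Z.
    apply: (@cvg_big R _ +%R) => [|i _]; [exact: add_continuous|exact: c0].
  have h : 0 < 2^-1 :> R by rewrite invr_gt0.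
  move/cvgr0Pnorm_le : c => /(_ _ h); apply: filterS => s; apply: le_trans.
  exact: ler_norm.
have N3 : \forall s \near (0 : R)^',
    `|\det (1%:M - s^-1 *: (AdM (seg x s) - 1%:M))| < 2^-1 ^+ n.
  have c : \det (1%:M - s^-1 *: (AdM (seg x s) - 1%:M)) @[s --> (0 : R)^'] --> (0 : R).
    by rewrite -[X in _ --> X]D0; apply: cvg_det_quotient => i j; exact: cvg_AdM_seg.
  have h : 0 < 2^-1 ^+ n :> R by rewrite exprn_gt0 // invr_gt0.
  by move/cvgr0Pnorm_lt : c => /(_ _ h).
have [r /= r0 Hr] := (nbhs_ballP _ _).1 (filterI N1 N2).
have [q /= q0 Hq] := (nbhs_ballP _ _).1 N3.
pose e := Num.min r q / 2.
have e0 : 0 < e by rewrite divr_gt0 // lt_min r0.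
have er : e < r.
  by rewrite ltr_pdivrMr // gt_min ltr_pMr // ltr1n.
have eq : e < q.
  by rewrite ltr_pdivrMr // gt_min [X in _ || X]ltr_pMr // ltr1n orbT.
have Br s : 0 <= s <= e -> ball 0 r s.
  move=> /andP[s0 se]; rewrite -ball_normE /= sub0r normrN ger0_norm //.
  exact: le_lt_trans er.
exists e; split => //.
- by move=> s /Br/Hr[].
- by move=> s /Br/Hr[].
- apply: Hq; last by rewrite /= gt_eqF.
  by rewrite -ball_normE /= sub0r normrN ger0_norm // ltW.
Qed.
End EigenStep.

Section Metric.
Variables (R : realType) (n : nat) (G : lieGroup R n).
Local Notation E := 'rV[R]_n.
Variable g : G -> E -> E -> R.
Hypothesis sg : semi_riemannian g.

Lemma metric0l p w : g p 0 w = 0.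
Proof.
have := metric_linear sg p 1 0 0 w.
by rewrite scaler0 addr0 mul1r => H; apply: (addrI (g p 0 w)); rewrite addr0 -H.
Qed.

Lemma metric_suml p m (c : 'I_m -> R) (f : 'I_m -> E) w :
  g p (\sum_j c j *: f j) w = \sum_j c j * g p (f j) w.
Proof.
elim/big_rec2 : _ => [|j y z _ <-]; first exact: metric0l.
exact: metric_linear.
Qed.

Lemma metric_sumr p m (c : 'I_m -> R) (f : 'I_m -> E) w :
  g p w (\sum_j c j *: f j) = \sum_j c j * g p w (f j).
Proof.
rewrite (Defs.metric_sym sg) metric_suml; apply: eq_bigr => j _.
by rewrite (Defs.metric_sym sg).
Qed.

(** The linear form [g_1(-, x)] of an idempotent [x] is fixed by the transpose
    of [ad x]: this is the defining property of the adjoint. *)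
Lemma idempotent_eigen (x : E) : is_idempotent g x ->
  exists lam : 'cV[R]_n, lam != 0 /\ lin1_mx (ad G x) *m lam = lam.
Proof.
move=> [x0 Ex].
have Hx u : g 1%g (ad G x u) x = g 1%g u x.
  move: Ex; rewrite /euler_arnold /dagger; case: xgetP => [w _ Hw Ew|_ x00].
    by rewrite Hw Ew.
  (* an absent adjoint would make the right-hand side the default value 0 *)
  by move: x0; rewrite -x00 eqxx.
have gsum (v w : E) : g 1%g v w = \sum_j v ord0 j * g 1%g (delta_mx ord0 j) w.
  by rewrite [v in LHS]row_sum_delta metric_suml.
exists (\col_j g 1%g (delta_mx ord0 j) x); split.
- apply: contra x0 => /eqP l0; apply/eqP.
  apply: (@Defs.metric_nondegenerate _ _ _ _ sg 1%g) => v.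
  rewrite (Defs.metric_sym sg) gsum big1 // => j _.
  by have /colP/(_ j) := l0; rewrite !mxE => ->; rewrite mulr0.
- apply/colP => i; rewrite !mxE -[RHS]Hx gsum; apply: eq_bigr => j _.
  by rewrite !mxE.
Qed.
End Metric.

(** * The curve *)

Section Curve.
Variables (R : realType) (n : nat) (G : lieGroup R n).
Local Notation E := 'rV[R]_n.
Local Notation A := (atlas G).
Local Notation c1 := (chartAt (atlas G) 1%g).
Local Notation e1 := (cmap (chartAt (atlas G) 1%g) 1%g).

Lemma smooth_at_seg (x : E) (u : R -> R) (s : R) :
  (cmap c1 @` cdom c1) (u s *: x + e1) -> smooth_germ u s ->
  smooth_at A (fun s => seg G x (u s)) s.
Proof.
move=> [q cq Eq] su.
apply: (@smooth_at_comp _ _ _ A _ _ (fun s => u s *: x + e1) (cinv c1)).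
- exact: has_coords_rV.
- apply: germD; last exact: germ_cst.
  by apply: germZ => //; exact: germ_cst.
- by rewrite -Eq; exact: smooth_at_cinv.
Qed.

Variables (x : E) (e : R).
Hypothesis e0 : 0 < e.
Hypothesis xe : forall s, 0 <= s <= e -> (cmap c1 @` cdom c1) (s *: x + e1).

Lemma germ_shift (phi : R -> R) (a t : R) : (forall s, smooth_germ phi s) ->
  smooth_germ (fun t => e * phi (t - a)) t.
Proof.
move=> sp; apply: (@germZ R R R (fun=> e)); first exact: germ_cst.
have gs : smooth_germ (fun t : R => t - a) t.
  by apply: germD; [exact: germ_id|exact: germ_cst].
exact: germ_comp (@has_coords_R R) gs (sp _).
Qed.

(** The powers of [seg x e], at integer times, are joined by translates of one
    segment; its parametrization is flat to infinite order at both ends. *)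
Lemma step_curve : exists p : R -> G, [/\ smooth_curve p, p 0 = 1%g &
  forall t, 0 <= t -> exists (k : nat) (a : R),
    [/\ k%:R <= t < k.+1%:R, 0 <= a <= e & p t = (seg G x e ^+ k * seg G x a)%g]].
Proof.
have [phi [sphi phi0 phi1 phi01]] := smooth_step R.
have ephi s : 0 <= e * phi s <= e.
  by have /andP[a b] := phi01 s; rewrite mulr_ge0 ?(ltW e0) //= ler_piMr // ltW.
pose h := seg G x e.
pose piece (m : nat) (t : R) := seg G x (e * phi (t - m%:R)).
have piece_smooth m t : smooth_at A (piece m) t.
  by apply: (@smooth_at_seg x) (germ_shift _ _ sphi); exact: xe.
have piece0 m t : t <= m%:R -> piece m t = 1%g.
  by move=> tm; rewrite /piece phi0 ?mulr0 ?seg0 // subr_le0.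
have piece1 m t : m.+1%:R <= t -> piece m t = h.
  by move=> tm; rewrite /piece phi1 ?mulr1 // lerBrDr nat1r.
pose p (t : R) := (h ^+ Num.truncn t * piece (Num.truncn t) t)%g.
exists p; split.
- move=> t t0; have /andP[tk kt] := Num.Theory.truncn_itv t0.
  case Ek : (Num.truncn t) tk kt => [|m] tk kt.
    apply: smooth_at_ext (piece_smooth 0%N t).
    have := lt_nbhsl kt; apply: filterS => s s1; rewrite /p.
    have /eqP -> : Num.truncn s == 0%N by rewrite -leqn0 Num.Theory.truncn_le_nat.
    by rewrite expg0 mul1g.
  (* On the interval from m to m + 2 one of the two pieces is always constant, so
     this product is p there, also around the junction at m + 1. *)
  have sm : smooth_at A (fun s => h ^+ m * piece m s * piece m.+1 s)%g t.
    apply: smooth_at_mul (piece_smooth _ _); apply: smooth_at_mul (piece_smooth _ _).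
    exact: smooth_at_cst.
  apply: smooth_at_ext sm.
  have mt : m%:R < t by apply: lt_le_trans tk; rewrite ltr_nat.
  apply: filterS2 (lt_nbhsr mt) (lt_nbhsl kt) => s ms sk; rewrite /p.
  have s0 : 0 <= s by apply: le_trans (ltW ms); rewrite ler0n.
  have [sm1|m1s] := ltP s m.+1%:R.
    have -> : Num.truncn s = m by apply: Num.Theory.truncn_def; rewrite (ltW ms).
    by rewrite (piece0 m.+1) ?(ltW sm1) // mulg1.
  have -> : Num.truncn s = m.+1 by apply: Num.Theory.truncn_def; rewrite m1s.
  by rewrite (piece1 m) // expgSr.
- by rewrite /p Num.Theory.truncn0 expg0 mul1g piece0.
- move=> t t0; exists (Num.truncn t), (e * phi (t - (Num.truncn t)%:R)).
  by split => //; exact: Num.Theory.truncn_itv.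
Qed.
End Curve.

(** * The norms of a Riemannian metric *)

Section Norms.
Variables (R : realType) (n : nat) (G : lieGroup R n).
Local Notation E := 'rV[R]_n.
Variable g : G -> E -> E -> R.
Hypothesis rg : riemannian g.

(** The rows of [P] form an orthonormal basis: the signature provides an
    orthogonal one with values [1] or [-1], and positivity excludes [-1]. *)
Lemma metric_coords p : exists Q P : 'M[R]_n,
  [/\ P *m Q = 1%:M, Q *m P = 1%:M &
   forall v, g p v v = \sum_i ((v *m Q) ord0 i) ^+ 2].
Proof.
have [sg pos] := rg; have [k _ /(_ p)[P Pu HP]] := metric_index sg.
exists (invmx P), P; split; [exact: mulmxV|exact: mulVmx|move=> v].
have H i j : g p (row i P) (row j P) = (i == j)%:R.
  rewrite HP; case: eqVneq => // _; case: ifP => // ik.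
  have : 0 < g p (row i P) (row i P).
    apply: pos; apply/negP => /eqP r0.
    have := congr1 (fun M => row i M) (mulmxV Pu).
    rewrite row_mul r0 mul0mx => /rowP/(_ i); rewrite !mxE eqxx => /eqP.
    by rewrite eq_sym oner_eq0.
  by rewrite HP eqxx ik oppr_gt0 ltr10.
have -> : g p v v = g p ((v *m invmx P) *m P) ((v *m invmx P) *m P).
  by rewrite mulmxKV.
rewrite mulmx_sum_row (metric_suml sg); apply: eq_bigr => i _.
rewrite (metric_sumr sg) (bigD1 i) //= H eqxx mulr1 big1 ?addr0 ?expr2 //.
by move=> j ji; rewrite H eq_sym (negbTE ji) mulr0.
Qed.

Lemma bnorm_ge0 p v : 0 <= bnorm (g p) v.
Proof. exact: sqrtr_ge0. Qed.

Lemma bnormZ p a v : bnorm (g p) (a *: v) = `|a| * bnorm (g p) v.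
Proof.
have [Q [P [_ _ H]]] := metric_coords p; rewrite /bnorm !H.
rewrite -sqrtr_sqr -sqrtrM ?sqr_ge0 //; congr Num.sqrt.
by rewrite mulr_sumr; apply: eq_bigr => i _; rewrite -scalemxAl mxE exprMn.
Qed.

Lemma bnorm_gt0 p v : v != 0 -> 0 < bnorm (g p) v.
Proof. by move=> v0; rewrite sqrtr_gt0; have [_] := rg; apply. Qed.

Lemma linear_bnorm_bound p (f : {linear E -> R}) :
  exists2 K, 0 <= K & forall v, `|f v| <= K * bnorm (g p) v.
Proof.
have [Q [P [_ QP H]]] := metric_coords p.
exists (\sum_i `|f (row i P)|); first by apply: sumr_ge0.
move=> v; have -> : v = (v *m Q) *m P by rewrite -mulmxA QP mulmx1.
rewrite [in leLHS]mulmx_sum_row linear_sum mulr_suml.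
apply: le_trans (ler_norm_sum _ _ _) _; apply: ler_sum => i _.
rewrite linearZ normrM mulrC ler_wpM2l // -mulmxA QP mulmx1.
rewrite /bnorm H -sqrtr_sqr ler_sqrt; last by apply: sumr_ge0 => j _; exact: sqr_ge0.
by rewrite (bigD1 i) //= lerDl sumr_ge0 // => j _; exact: sqr_ge0.
Qed.

Lemma row_sum_bound p (f : {linear E -> 'rV[R]_n}) :
  exists2 K, 0 <= K & forall v, \sum_j `|f v ord0 j| <= K * bnorm (g p) v.
Proof.
have Hj j := linear_bnorm_bound p [the {linear E -> R} of coordf j \o f].
exists (\sum_j s2val (cid2 (Hj j))).
  by apply: sumr_ge0 => j _; case: cid2.
move=> v; rewrite mulr_suml; apply: ler_sum => j _.
by case: cid2 => K K0 /= /(_ v).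
Qed.

Lemma bnorm_linear_bound p (f : {linear E -> E}) :
  exists2 K, 0 <= K & forall v, bnorm (g p) (f v) <= K * bnorm (g p) v.
Proof.
have [Q [P [_ _ H]]] := metric_coords p.
have [K K0 HK] := row_sum_bound p [the {linear E -> E} of mulmxr Q \o f].
exists K => // v; apply: le_trans (HK v); rewrite {1}/bnorm H.
have sq m (a : 'I_m -> R) : \sum_i a i ^+ 2 <= (\sum_i `|a i|) ^+ 2.
  elim: m a => [|m IH] a; first by rewrite !big_ord0 expr0n.
  rewrite !big_ord_recl sqrrD -real_normK ?num_real // -addrA lerD2l.
  apply: le_trans (IH _) _; rewrite lerDr mulrn_wge0 // mulr_ge0 //.
  by apply: sumr_ge0.
apply: le_trans (_ : Num.sqrt ((\sum_i `|(f v *m Q) ord0 i|) ^+ 2) <= _).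
  by rewrite ler_sqrt ?sqr_ge0.
by rewrite sqrtr_sqr ger0_norm // sumr_ge0.
Qed.

(** The supremum defining the operator norm is over a bounded set by
    [bnorm_linear_bound]; it would otherwise be a default value. *)
Lemma opnorm_ge p (f : {linear E -> E}) v :
  bnorm (g p) (f v) <= opnorm (g p) f * bnorm (g p) v.
Proof.
have [->|v0] := eqVneq v 0.
  by rewrite linear0 /bnorm (metric0l rg.1) sqrtr0 mulr0.
have bv := bnorm_gt0 p v0.
rewrite -ler_pdivrMr // /opnorm; apply: ub_le_sup.
  have [K K0 HK] := bnorm_linear_bound p f; exists K => _ [w /= w1 <-].
  by apply: le_trans (HK w) _; rewrite ler_piMr.
exists ((bnorm (g p) v)^-1 *: v).
  by rewrite /= bnormZ ger0_norm ?invr_ge0 ?(ltW bv) // mulVf // gt_eqF.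
by rewrite linearZ bnormZ ger0_norm ?invr_ge0 ?(ltW bv) // mulrC.
Qed.
End Norms.

Section AdNorm.
Variables (R : realType) (n : nat) (G : lieGroup R n).
Local Notation E := 'rV[R]_n.
Variable g : G -> E -> E -> R.
Hypothesis rg : riemannian g.

Lemma AdM_opnorm : exists2 K, 0 <= K &
  forall q : G, \sum_i \sum_j `|AdM q i j| <= K * opnorm (g 1%g) (Ad q).
Proof.
have [K K0 HK] := row_sum_bound rg 1%g [the {linear E -> E} of idfun].
exists (\sum_i K * bnorm (g 1%g) (delta_mx ord0 i)).
  by apply: sumr_ge0 => i _; rewrite mulr_ge0 // bnorm_ge0.
move=> q; rewrite mulr_suml; apply: ler_sum => i _.
have := opnorm_ge rg 1%g [the {linear E -> E} of mulmxr (AdM q)] (delta_mx ord0 i).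
have Ef : mulmxr (AdM q) = Ad q :> (E -> E) by apply/funext => v; exact: AdME.
rewrite /= AdME.
have -> : opnorm (g 1%g) (mulmxr (AdM q)) = opnorm (g 1%g) (Ad q) by rewrite Ef.
move=> H; rewrite -mulrA [_ * opnorm _ _]mulrC.
apply: le_trans (ler_wpM2l K0 H).
apply: le_trans (HK _); apply: ler_sum => j _.
by rewrite AdM_entry.
Qed.
End AdNorm.

(** * Length and speed *)

Section UnitIntegral.
Variable R : realType.
Local Notation mu := (@lebesgue_measure R).
Implicit Types f F : R -> R.

Lemma within01 f : (forall t : R, 0 <= t <= 1 -> {for t, continuous f}) ->
  {within `[0%R, 1%R], continuous f}.
Proof.
by move=> cf; apply: continuous_in_subspaceT => t /set_mem /=; rewrite in_itv; exact: cf.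
Qed.

Lemma integrable01 f : (forall t : R, 0 <= t <= 1 -> {for t, continuous f}) ->
  mu.-integrable `[0%R, 1%R] (EFin \o f).
Proof.
move=> cf; apply: continuous_compact_integrable; first exact: segment_compact.
exact: within01.
Qed.

Lemma integral01_le f (M : R) : (forall t : R, 0 <= t <= 1 -> {for t, continuous f}) ->
  (forall t : R, 0 <= t <= 1 -> f t <= M) ->
  (\int[mu]_(t in `[0%R, 1%R]) (f t)%:E <= M%:E)%E.
Proof.
move=> cf fM.
have : (\int[mu]_(t in `[0%R, 1%R]) (f t)%:E <= \int[mu]_(t in `[0%R, 1%R]) (cst M%:E) t)%E.
  apply: le_integral => //; first exact: integrable01.
    by apply: (@integrable01 (cst M)) => t _; exact: cst_continuous.
  by move=> t /set_mem /=; rewrite in_itv lee_fin => /fM.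
rewrite integral_cst //= lebesgue_measure_itv /= lte_fin ltr01 sube0 mule1.
exact.
Qed.

Lemma integral01_ge f F (K : R) : 0 <= K ->
  (forall t : R, 0 <= t <= 1 -> {for t, continuous f}) ->
  (forall t : R, 0 <= t <= 1 -> 0 <= f t) ->
  (forall t : R, 0 <= t <= 1 -> differentiable F t) ->
  (forall t : R, 0 <= t <= 1 -> {for t, continuous ('D_1 F)}) ->
  (forall t : R, 0 <= t <= 1 -> 'D_1 F t <= K * f t) ->
  ((F 1 - F 0)%:E <= K%:E * \int[mu]_(t in `[0%R, 1%R]) (f t)%:E)%E.
Proof.
move=> K0 cf f0 dF cF Ff.
have h0 : 0 <= (0 : R) <= 1 by rewrite lexx ler01.
have h1 : 0 <= (1 : R) <= 1 by rewrite lexx ler01.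
rewrite EFinB -(@continuous_FTC2 R ('D_1 F) F 0 1 ltr01); last 3 first.
- exact: within01.
- split.
  + by move=> t; rewrite in_itv /= => /andP[t0 t1]; apply/derivable1_diffP/dF; rewrite !ltW.
  + exact: cvg_at_right_filter (differentiable_continuous (dF _ h0)).
  + exact: cvg_at_left_filter (differentiable_continuous (dF _ h1)).
- by move=> t _; rewrite derive1E.
rewrite -ge0_integralZl //=; last by have /measurable_int := integrable01 cf.
apply: le_integral => //.
- exact: integrable01.
- apply: (@integrable01 (fun t => K * f t)) => t ht.
  by apply: cvgM; [exact: cvg_cst|exact: cf].
- by move=> t /set_mem /=; rewrite in_itv -EFinM lee_fin => /Ff.
Qed.
End UnitIntegral.

Section Speed.
Variables (R : realType) (n : nat) (G : lieGroup R n).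
Local Notation E := 'rV[R]_n.
Local Notation A := (atlas G).
Local Notation chart_ p := (chartAt (atlas G) p).
Local Notation c1 := (chartAt (atlas G) 1%g).
Local Notation e1 := (cmap (chartAt (atlas G) 1%g) 1%g).
Variable g : G -> E -> E -> R.
Hypothesis rg : riemannian g.

Definition speed (gamma : R -> G) (t : R) : R :=
  bnorm (g (gamma t)) (velocity gamma t).

Lemma speed_ge0 gamma t : 0 <= speed gamma t.
Proof. exact: sqrtr_ge0. Qed.

Lemma from_chart_sum (c : chart R n G) p (v : E) :
  from_chart c p v = \sum_j v ord0 j *: from_chart c p (delta_mx ord0 j).
Proof.
rewrite {1}[v]row_sum_delta /from_chart linear_sum; apply: eq_bigr => j _.
by rewrite linearZ.
Qed.

(** In a chart the squared speed is a quadratic expression in the derivative of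
    the curve, with coefficients that depend smoothly on the point. *)
Lemma germ_speed2 (gamma : R -> G) t : smooth_at A gamma t ->
  smooth_germ (fun s => g (gamma s) (velocity gamma s) (velocity gamma s)) t.
Proof.
move=> sg; have dt := chartAt_dom A (gamma t).
set c := chart_ (gamma t); pose zeta : R -> E := cmap c \o gamma.
have sz : smooth_germ zeta t := smooth_at_germ sg dt.
pose Gij i j z := g (cinv c z) (from_chart c (cinv c z) (delta_mx ord0 i))
  (from_chart c (cinv c z) (delta_mx ord0 j)).
have sG i j : smooth_germ (Gij i j) (zeta t).
  exists (cmap c @` cdom c); split; first exact: cimg_open.
    by exists (gamma t).
  exact: (metric_smooth rg.1 (gamma t) (delta_mx ord0 i) (delta_mx ord0 j)).
have sd j : smooth_germ (fun s => coordf j ('D_1 zeta s)) t.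
  apply: (@germ_comp _ _ _ _ ('D_1 zeta) (coordf j)).
  - exact: has_coords_rV.
  - exact: germ_derive.
  - by apply: germ_lin; exact: coordf_cont.
apply: (@germ_ext _ _ _ (fun s => \sum_i \sum_j
   coordf i ('D_1 zeta s) *: (coordf j ('D_1 zeta s) *: (Gij i j \o zeta) s))).
  apply: filterS2 (smooth_at_near sg) (near_cdom sg.1 dt) => s ss ds.
  rewrite (velocity_chart ss ds) from_chart_sum (metric_suml rg.1).
  apply: eq_bigr => i _; rewrite (metric_sumr rg.1) mulr_sumr; apply: eq_bigr => j _.
  by rewrite /Gij /= /zeta /= (cmapK ds) derive1E.
apply: germ_sum => i; apply: germ_sum => j.
apply: (@germZ R R R) (sd i) _; apply: (@germZ R R R) (sd j) _.
exact: germ_comp (has_coords_rV _ _) sz (sG i j).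
Qed.

Lemma speed_continuous (gamma : R -> G) t : smooth_at A gamma t ->
  {for t, continuous (speed gamma)}.
Proof.
move=> sg; apply: continuous_comp; first exact: germ_cont (germ_speed2 sg).
exact: sqrt_continuous.
Qed.

Hypothesis li : left_invariant g.

Lemma speed_lmul (gamma : R -> G) (h : G) t : smooth_at A gamma t ->
  speed (fun s => h * gamma s)%g t = speed gamma t.
Proof.
move=> sg; rewrite /speed /bnorm.
have -> : velocity (fun s => h * gamma s)%g t =
    mdiff (fun q => h * q)%g (gamma t) (velocity gamma t).
  exact: velocity_comp sg (smooth_lmul _ _).
by rewrite li.
Qed.

Lemma velocity_scale (gamma : R -> G) (a s : R) : smooth_at A gamma (s * a) ->
  velocity (fun s => gamma (s * a)) s = a *: velocity gamma (s * a).
Proof.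
move=> sg; rewrite /velocity.
set F : R -> E := cmap (chart_ (gamma (s * a))) \o gamma.
have dF : differentiable F (s * a).
  exact: germ_diff (smooth_at_germ sg (chartAt_dom A _)).
have [dm Em] : is_diff s (fun s : R => s * a) (fun v : R => v *: a).
  exact: is_diff_scalel.
have dc := differentiable_comp dm dF.
rewrite (derive1E' dF); apply: etrans (derive1E' dc) _.
have H := diff_comp dm dF.
apply: etrans (congr1 (fun f => f 1) H) _.
rewrite /= Em; have -> : (1 : R) *: a = a *: (1 : R) by exact: mulrC.
by rewrite linearZ.
Qed.

Lemma speed_scale (gamma : R -> G) (a s : R) : 0 <= a ->
  smooth_at A gamma (s * a) ->
  speed (fun s => gamma (s * a)) s = a * speed gamma (s * a).
Proof.
by move=> a0 sg; rewrite /speed velocity_scale // (bnormZ rg) ger0_norm.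
Qed.
End Speed.

(** * The distance grows at most linearly along the discrete subgroup *)

Section Steps.
Variables (R : realType) (n : nat) (G : lieGroup R n).
Local Notation E := 'rV[R]_n.
Local Notation A := (atlas G).
Local Notation c1 := (chartAt (atlas G) 1%g).
Local Notation e1 := (cmap (chartAt (atlas G) 1%g) 1%g).
Variable g : G -> E -> E -> R.
Hypotheses (rg : riemannian g) (li : left_invariant g).
Variables (x : E) (e : R).
Hypothesis e0 : 0 < e.
Hypothesis xe : forall s, 0 <= s <= e -> (cmap c1 @` cdom c1) (s *: x + e1).
Local Notation h := (seg G x e).

(** By left invariance and compactness of [[0, e]], the successive steps have
    uniformly bounded length. *)
Lemma rdist_steps : exists2 L, 0 <= L & forall (k : nat) (a : R), 0 <= a <= e ->
  (rdist g 1%g (h ^+ k * seg G x a)%g <= (k.+1%:R * L)%:E)%E.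
Proof.
have sm s : 0 <= s <= e -> smooth_at A (seg G x) s.
  by move=> se; apply: (@smooth_at_seg _ _ _ x id s); [exact: xe|exact: germ_id].
have [u ue Hu] : exists2 c, c \in `[0, e] & forall t, t \in `[0, e] ->
    speed g (seg G x) t <= speed g (seg G x) c.
  apply: EVT_max; first exact: ltW.
  apply: continuous_in_subspaceT => t /set_mem /=; rewrite in_itv => te.
  by apply: speed_continuous => //; exact: sm.
pose L := e * speed g (seg G x) u.
have L0 : 0 <= L by rewrite mulr_ge0 ?(ltW e0) // speed_ge0.
have piece (q : G) (a : R) : 0 <= a <= e ->
    (forall t, 0 <= t <= 1 -> smooth_at A (fun s : R => q * seg G x (s * a))%g t) /\
    (curve_length g (fun s => q * seg G x (s * a))%g <= L%:E)%E.
  move=> /andP[a0 ae].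
  have ta (t : R) : 0 <= t <= 1 -> 0 <= t * a <= e.
    by move=> /andP[t0 t1]; rewrite mulr_ge0 //= (le_trans _ ae) // ler_piMl.
  have ga (t : R) : smooth_germ (fun t : R => t * a) t.
    apply: (@germZ R R R id (fun=> a)); [exact: germ_id|exact: germ_cst].
  have sa (t : R) : 0 <= t <= 1 -> smooth_at A (fun s : R => seg G x (s * a)) t.
    by move=> /ta te; apply: (@smooth_at_seg _ _ _ x (fun t => t * a)) => //; exact: xe.
  have sq (t : R) : 0 <= t <= 1 -> smooth_at A (fun s : R => q * seg G x (s * a))%g t.
    by move=> /sa st; apply: smooth_at_mul st; exact: smooth_at_cst.
  split=> //; apply: (@integral01_le R (speed g (fun s => q * seg G x (s * a))%g)).
    by move=> t /sq; exact: speed_continuous.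
  move=> t t01; rewrite speed_lmul //; last exact: sa.
  rewrite (speed_scale rg a0 (sm _ (ta _ t01))).
  have st : speed g (seg G x) (t * a) <= speed g (seg G x) u.
    by apply: Hu; rewrite in_itv; exact: ta.
  exact: ler_pM a0 (speed_ge0 _ _ _) ae st.
have he : 0 <= e <= e by rewrite (ltW e0) lexx.
have steps k : exists2 l, path_of_length g 1%g (h ^+ k)%g l & (l <= (k%:R * L)%:E)%E.
  elim: k => [|k [l pl lL]].
    by exists 0%E; [exact: path_nil|rewrite mul0r].
  have [sp cl] := piece (h ^+ k)%g e he.
  exists (l + curve_length g (fun s => h ^+ k * seg G x (s * e))%g)%E.
    have := @path_rcons _ _ _ g 1%g _ l (fun s => h ^+ k * seg G x (s * e))%g pl.
    rewrite mul0r seg0 mulg1 mul1r -expgSr; apply => //.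
  by rewrite -natr1 mulrDl mul1r EFinD leeD.
exists L => // k a ae; have [l pl lL] := steps k; have [sp cl] := piece (h ^+ k)%g a ae.
apply: le_trans (_ : l + curve_length g (fun s => h ^+ k * seg G x (s * a))%g <= _)%E.
  apply: ereal_inf_lbound => /=.
  have := @path_rcons _ _ _ g 1%g _ l (fun s => h ^+ k * seg G x (s * a))%g pl.
  by rewrite mul0r seg0 mulg1 mul1r; apply.
by rewrite -natr1 mulrDl mul1r EFinD leeD.
Qed.
End Steps.

(** * The adjoint representation grows at most exponentially with length *)

Section BodyVelocity.
Variables (R : realType) (n : nat) (G : lieGroup R n).
Local Notation E := 'rV[R]_n.
Local Notation A := (atlas G).
Local Notation c1 := (chartAt (atlas G) 1%g).
Local Notation e1 := (cmap (chartAt (atlas G) 1%g) 1%g).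

(** [gamma] near [t], translated to pass through the identity at time [t]. *)
Definition body_coords (gamma : R -> G) (t : R) : R -> E :=
  cmap c1 \o (fun s => (gamma t)^-1 * gamma s)%g.
Definition body_velocity (gamma : R -> G) (t : R) : E :=
  'D_1 (body_coords gamma t) t.

Let sm_body (gamma : R -> G) t : smooth_at A gamma t ->
  smooth_at A (fun s => (gamma t)^-1 * gamma s)%g t.
Proof. by move=> sg; apply: smooth_at_mul sg; exact: smooth_at_cst. Qed.

Let dom_body (gamma : R -> G) t : cdom c1 ((gamma t)^-1 * gamma t)%g.
Proof. by rewrite mulVg; exact: dom1. Qed.

Lemma body_coords_t (gamma : R -> G) t : body_coords gamma t t = e1.
Proof. by rewrite /body_coords /= mulVg. Qed.

Lemma AdM_near (gamma : R -> G) t : smooth_at A gamma t ->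
  \forall s \near t, AdM (gamma s) =
     AdM (cinv c1 (body_coords gamma t s)) *m AdM (gamma t).
Proof.
move=> sg; have := smooth_at_local (sm_body sg) (dom_body gamma t).
apply: filterS => s Es; rewrite -AdM_mul; congr AdM.
have E1 : ((gamma t)^-1 * gamma s)%g = cinv c1 (body_coords gamma t s) := Es.
by rewrite -E1 mulgA mulgV mul1g.
Qed.

Lemma germ_body (gamma : R -> G) t : smooth_at A gamma t ->
  smooth_germ (body_coords gamma t) t.
Proof. by move=> sg; exact: smooth_at_germ (sm_body sg) (dom_body gamma t). Qed.

Let germ_AdM_body (gamma : R -> G) t i k : smooth_at A gamma t ->
  smooth_germ (fun s => AdM (cinv c1 (body_coords gamma t s)) i k) t.
Proof.
move=> sg.
apply: (@germ_comp _ _ _ _ (body_coords gamma t) (fun z => AdM (cinv c1 z) i k)).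
- exact: has_coords_rV.
- exact: germ_body.
- by rewrite body_coords_t; exact: germ_AdM.
Qed.

Lemma germ_AdM_curve (gamma : R -> G) t i j : smooth_at A gamma t ->
  smooth_germ (fun s => AdM (gamma s) i j) t.
Proof.
move=> sg; apply: (@germ_ext _ _ _ (fun s =>
  \sum_k AdM (cinv c1 (body_coords gamma t s)) i k *: AdM (gamma t) k j)).
  by apply: filterS (AdM_near sg) => s ->; rewrite [RHS]mxE.
apply: germ_sum => k.
apply: (@germZ R R R _ (fun=> AdM (gamma t) k j)); last exact: germ_cst.
exact: germ_AdM_body.
Qed.

(** Since [Ad] is a homomorphism, its derivative along a curve is its derivative
    at the identity, applied to the translated velocity, times its value. *)
Lemma derive_AdM_curve (gamma : R -> G) t i j : smooth_at A gamma t ->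
  'D_1 (fun s => AdM (gamma s) i j) t =
  (lin1_mx (ad G (body_velocity gamma t)) *m AdM (gamma t)) i j.
Proof.
move=> sg.
have nE : \forall s \near t, AdM (gamma s) i j =
    \sum_k AdM (cinv c1 (body_coords gamma t s)) i k *: AdM (gamma t) k j.
  by apply: filterS (AdM_near sg) => s ->; rewrite [LHS]mxE.
have du k := germ_diff (germ_AdM_body i k sg).
rewrite (near_eq_derive _ nE) [RHS]mxE.
rewrite (_ : (fun s => _) = \sum_k (fun s =>
  AdM (cinv c1 (body_coords gamma t s)) i k *: AdM (gamma t) k j)); last first.
  by apply/funext => s; rewrite fct_sumE.
have dk k : differentiable
    (fun s => AdM (cinv c1 (body_coords gamma t s)) i k *: AdM (gamma t) k j) t.
  exact: differentiableZl.
rewrite derive_sum; last by move=> k; exact: diff_derivable.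
apply: eq_bigr => k _; rewrite (deriveE _ (dk k)) diffZl //=; congr (_ * _).
rewrite -deriveE // -derive_AdM /body_velocity.
have db := germ_diff (germ_body sg).
have dA : differentiable (fun z => AdM (cinv c1 z) i k) (body_coords gamma t t).
  by rewrite body_coords_t; exact: germ_diff (germ_AdM _ _ _).
have H := diff_comp db dA; rewrite body_coords_t in H.
have dA1 := germ_diff (@germ_AdM _ _ G i k).
apply: etrans (deriveE _ (differentiable_comp db dA)) _.
apply: etrans (congr1 (fun f => f 1) H) _.
apply: etrans _ (esym (deriveE _ dA1)).
have Ed : 'd (body_coords gamma t) t 1 = 'D_1 (body_coords gamma t) t.
  by apply/esym; exact: deriveE.
by rewrite -Ed.
Qed.

Variable g : G -> E -> E -> R.
Hypotheses (rg : riemannian g) (li : left_invariant g).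

(** Left translation is an isometry. *)
Lemma body_velocity_speed (gamma : R -> G) t : smooth_at A gamma t ->
  bnorm (g 1%g) (body_velocity gamma t) = speed g gamma t.
Proof.
move=> sg; rewrite -(speed_lmul li (gamma t)^-1%g sg) /speed mulVg; congr bnorm.
by rewrite /velocity /= mulVg derive1E.
Qed.

End BodyVelocity.

Section AdGrowth.
Variables (R : realType) (n : nat) (G : lieGroup R n).
Local Notation E := 'rV[R]_n.
Local Notation A := (atlas G).
Local Notation c1 := (chartAt (atlas G) 1%g).
Local Notation e1 := (cmap (chartAt (atlas G) 1%g) 1%g).

Lemma derive_sum_fun (V W : normedModType R) m (f : 'I_m -> V -> W) x v :
  (forall i, differentiable (f i) x) ->
  'D_v (fun y => \sum_i f i y) x = \sum_i 'D_v (f i) x.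
Proof.
move=> df; rewrite (_ : (fun y => _) = \sum_i f i); last first.
  by apply/funext => y; rewrite fct_sumE.
by rewrite derive_sum // => i; exact: diff_derivable.
Qed.

Definition sqnorm (M : 'M[R]_n) : R := \sum_i \sum_j M i j * M i j.

Lemma sqnorm_ge0 M : 0 <= sqnorm M.
Proof.
by apply: sumr_ge0 => i _; apply: sumr_ge0 => j _; rewrite -expr2 sqr_ge0.
Qed.

Lemma sqr_le_sqnorm (M : 'M[R]_n) i j : M i j * M i j <= sqnorm M.
Proof.
rewrite /sqnorm (bigD1 i) //= (bigD1 j) //= -addrA lerDl.
apply: addr_ge0; first by apply: sumr_ge0 => k _; rewrite -expr2 sqr_ge0.
by apply: sumr_ge0 => k _; apply: sumr_ge0 => l _; rewrite -expr2 sqr_ge0.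
Qed.

(** The bilinear form on the left is the derivative of [sqnorm] at [M] in the
    direction [L *m M]; each product of two entries of [M] is at most
    [sqnorm M]. *)
Lemma sqnorm_mul (L M : 'M[R]_n) :
  \sum_i \sum_j (M i j * (L *m M) i j + (L *m M) i j * M i j) <=
  2 * n%:R * (\sum_i \sum_k `|L i k|) * sqnorm M.
Proof.
have H i j k : `|M i j| * `|M k j| <= sqnorm M.
  have := sqr_le_sqnorm M i j; have := sqr_le_sqnorm M k j.
  rewrite -(normr_id (M i j)) -(normr_id (M k j)).
  rewrite -[M i j * _]expr2 -[M k j * _]expr2 -(real_normK (num_real (M i j))).
  rewrite -(real_normK (num_real (M k j))) !normr_id.
  have := sqr_ge0 (`|M i j| - `|M k j|); move: `|M i j| `|M k j| => a b; nra.
have -> : 2 * n%:R * (\sum_i \sum_k `|L i k|) * sqnorm M =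
    \sum_i \sum_(j < n) 2 * ((\sum_k `|L i k|) * sqnorm M).
  under [RHS]eq_bigr do rewrite sumr_const card_ord.
  rewrite -[LHS]mulrA [_ * sqnorm M]mulr_suml mulr_sumr; apply: eq_bigr => i _.
  by rewrite -[RHS]mulr_natl mulrA [2 * _]mulrC.
apply: ler_sum => i _; apply: ler_sum => j _.
rewrite [(L *m M) i j * _]mulrC -mulr2n -[X in X <= _]mulr_natl.
rewrite ler_wpM2l // mxE mulr_sumr mulr_suml.
apply: ler_sum => k _; apply: le_trans (ler_norm _) _; rewrite !normrM mulrCA.
by rewrite ler_wpM2l.
Qed.

Lemma derive_sqnorm (gamma : R -> G) t : smooth_at A gamma t ->
  'D_1 (fun s => sqnorm (AdM (gamma s))) t =
  let M := AdM (gamma t) in let L := lin1_mx (ad G (body_velocity gamma t)) in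
  \sum_i \sum_j (M i j * (L *m M) i j + (L *m M) i j * M i j).
Proof.
move=> sg; have da i j := germ_diff (germ_AdM_curve i j sg).
have dd i j := is_diff_scale (da i j) (da i j).
have d2 i j : differentiable (fun s => AdM (gamma s) i j * AdM (gamma s) i j) t.
  by have [] := dd i j.
have ds i : differentiable (fun s => \sum_j AdM (gamma s) i j * AdM (gamma s) i j) t.
  rewrite (_ : (fun s => _) =
    \sum_j (fun s => AdM (gamma s) i j * AdM (gamma s) i j)).
    exact: differentiable_sum.
  by apply/funext => s; rewrite fct_sumE.
rewrite /sqnorm derive_sum_fun //; apply: eq_bigr => i _.
rewrite derive_sum_fun //; apply: eq_bigr => j _.
rewrite (deriveE _ (d2 i j)).
have [_ Ed] := dd i j; apply: etrans (congr1 (fun f => f 1) Ed) _.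
by rewrite /= -deriveE // derive_AdM_curve.
Qed.

Lemma germ_sqnorm (gamma : R -> G) t : smooth_at A gamma t ->
  smooth_germ (fun s => sqnorm (AdM (gamma s))) t.
Proof.
move=> sg; apply: germ_sum => i; apply: germ_sum => j.
by apply: (@germZ R R R); exact: germ_AdM_curve.
Qed.

Variable g : G -> E -> E -> R.
Hypotheses (rg : riemannian g) (li : left_invariant g).

Lemma ad_bound : exists2 K, 0 <= K & forall w : E,
  \sum_i \sum_j `|lin1_mx (ad G w) i j| <= K * bnorm (g 1%g) w.
Proof.
have H i j := linear_bnorm_bound rg 1%g ('d (fun z => AdM (cinv c1 z) i j) e1).
exists (\sum_i \sum_j s2val (cid2 (H i j))).
  by apply: sumr_ge0 => i _; apply: sumr_ge0 => j _; case: cid2.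
move=> w; rewrite mulr_suml; apply: ler_sum => i _.
rewrite mulr_suml; apply: ler_sum => j _.
case: cid2 => K K0 /= /(_ w); rewrite -deriveE; last exact: germ_diff (germ_AdM _ _ _).
by rewrite derive_AdM.
Qed.

(** Along a curve, [AdM] solves a linear equation whose coefficient is bounded
    by the speed; hence the logarithm of its norm grows at most linearly with
    the length. The summand [1] keeps the logarithm smooth without discussing
    whether the norm vanishes. *)
Lemma log_sqnorm_curve : exists2 K, 0 <= K & forall gamma : R -> G,
  (forall t : R, 0 <= t <= 1 -> smooth_at A gamma t) ->
  ((ln (1 + sqnorm (AdM (gamma 1))) - ln (1 + sqnorm (AdM (gamma 0))))%:E
   <= K%:E * curve_length g gamma)%E.
Proof.
have [K K0 HK] := ad_bound.
have n2 : 0 <= 2 * n%:R :> R by rewrite mulr_ge0.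
exists (2 * n%:R * K); first by rewrite mulr_ge0.
move=> gamma sg.
pose F s := sqnorm (AdM (gamma s)).
pose Phi s := ln (1 + F s).
have F0 s : 0 < 1 + F s by rewrite ltr_wpDr // sqnorm_ge0.
have dPhi (t : R) : smooth_at A gamma t ->
    is_derive t (1 : R) Phi ((1 + F t)^-1 * 'D_1 F t).
  move=> st; have dF := germ_diff (germ_sqnorm st).
  have d1 : is_derive t (1 : R) (fun s => 1 + F s) ('D_1 F t).
    have d : is_derive t (1 : R) F ('D_1 F t) by apply/derivableP/diff_derivable.
    have := is_deriveD (is_derive_cst (1 : R) t (1 : R)) d.
    by rewrite add0r.
  exact: (@is_derive1_comp _ (@ln R) (fun s => 1 + F s) _ _ _ (is_derive1_ln (F0 t)) d1).
apply: (@integral01_ge R (speed g gamma) Phi).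
- by rewrite mulr_ge0.
- by move=> t /sg; exact: speed_continuous.
- by move=> t _; exact: speed_ge0.
- by move=> t /sg/dPhi[d _]; exact/derivable1_diffP.
- move=> t /sg st.
  have c : {for t, continuous (fun s => (1 + F s)^-1 * 'D_1 F s)}.
    apply: continuousM; last exact: germ_cont (germ_derive _ (germ_sqnorm st)).
    apply: continuousV; first by rewrite gt_eqF.
    apply: continuousD; first exact: cst_continuous.
    exact: germ_cont (germ_sqnorm st).
  have nE : \forall s \near t, (1 + F s)^-1 * 'D_1 F s = 'D_1 Phi s.
    apply: filterS (smooth_at_near st) => s /dPhi d.
    by rewrite derive_val.
  rewrite /prop_for /continuous_at -(nbhs_singleton nE).
  by apply: (cvg_trans _ c); exact: near_eq_cvg.
- move=> t /sg st; have d := dPhi _ st; rewrite derive_val mulrC ler_pdivrMr //.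
  rewrite derive_sqnorm //; apply: le_trans (sqnorm_mul _ _) _.
  rewrite -(body_velocity_speed li st) -[leLHS]mulrA.
  rewrite -[2 * n%:R * K * _]mulrA -[leRHS]mulrA ler_wpM2l //.
  apply: ler_pM; rewrite ?sqnorm_ge0 ?lerDr //.
  by apply: sumr_ge0 => i _; apply: sumr_ge0.
Qed.

Lemma log_sqnorm_path : exists2 K, 0 <= K & forall (q : G) l,
  path_of_length g 1%g q l ->
  ((ln (1 + sqnorm (AdM q)))%:E <= (ln (1 + sqnorm (AdM (1%g : G))))%:E + K%:E * l)%E.
Proof.
have [K K0 HK] := log_sqnorm_curve; exists K => // q l.
suff H : path_of_length g 1%g q l -> (0 <= l)%E /\
  ((ln (1 + sqnorm (AdM q)))%:E <= (ln (1 + sqnorm (AdM (1%g : G))))%:E + K%:E * l)%E.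
  by move=> /H[].
elim=> [|{}q {}l gamma _ [l0 IH] g0 sg]; first by rewrite mule0 adde0.
have c0 : (0 <= curve_length g gamma)%E.
  by apply: integral_ge0 => t _; rewrite lee_fin sqrtr_ge0.
split; first exact: adde_ge0.
rewrite ge0_muleDr // addeA.
apply: (@le_trans _ _ ((ln (1 + sqnorm (AdM q)))%:E + K%:E * curve_length g gamma)%E).
  by have := HK _ sg; rewrite g0 EFinB leeBlDl.
by apply: leeD; [exact: IH|exact: lexx].
Qed.
End AdGrowth.

(** * Exponential growth along the curve *)

Section Growth.
Variables (R : realType) (n : nat) (G : lieGroup R n).
Local Notation E := 'rV[R]_n.

(** [det_growth] for the powers of [seg x e]; the last factor [seg x a] is close
    to the identity. *)
Lemma steps_growth (x : E) (e : R) : 0 < e ->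
  (forall s, 0 <= s <= e -> forall j,
      \sum_i `|AdM (seg G x s) i j - (i == j)%:R| <= 2^-1) ->
  `|\det (1%:M - e^-1 *: (AdM (seg G x e) - 1%:M))| < 2^-1 ^+ n ->
  forall (k : nat) (a : R), 0 <= a <= e ->
  (1 + e / 2) ^+ k / 2 <= \sum_i \sum_j `|AdM (seg G x e ^+ k * seg G x a)%g i j|.
Proof.
move=> e0 Hs Hd k a ae.
apply: (@det_growth _ _ (fun k => AdM (seg G x e ^+ k * seg G x a)%g)
  (e^-1 *: (AdM (seg G x e) - 1%:M))) => //.
- move=> m; rewrite scalerA mulfV ?gt_eqF // scale1r addrC subrK.
  by rewrite -AdM_mul expgS mulgA.
- by move=> j; rewrite expg0 mul1g; exact: Hs.
Qed.

Lemma sum_norm_le (M : 'M[R]_n) :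
  \sum_i \sum_j `|M i j| <= n%:R * n%:R * (1 + sqnorm M).
Proof.
have -> : n%:R * n%:R * (1 + sqnorm M) = \sum_(i < n) \sum_(j < n) (1 + sqnorm M).
  under [RHS]eq_bigr do rewrite sumr_const card_ord.
  by rewrite sumr_const card_ord -[RHS]mulr_natl -[X in _ = _ * X]mulr_natl mulrA.
apply: ler_sum => i _; apply: ler_sum => j _.
have := sqr_le_sqnorm M i j; rewrite -expr2 -(real_normK (num_real (M i j))).
move: (sqnorm M) `|M i j| => s b; nra.
Qed.
End Growth.

Theorem proposition5p12 (R : realType) (n : nat) (G : lieGroup R n)
    (hG : exists g : G -> 'rV[R]_n -> 'rV[R]_n -> R,
        semi_riemannian g /\ left_invariant g /\
        exists x0 : 'rV[R]_n, is_idempotent g x0) :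
  exists p : R -> G, smooth_curve p /\ exponential_growth_along p.
Proof.
have [b [sb [_ [x idx]]]] := hG.
have [lam [lam0 Elam]] := idempotent_eigen sb idx.
have [e [e0 xe Hs Hd]] := eigen_step lam0 Elam.
have [p [sp p0 Hp]] := step_curve e0 xe.
have grow := steps_growth e0 Hs Hd.
exists p; split=> //; split=> // g rg li.
set r := 1 + e / 2 in grow.
have r1 : 1 < r by rewrite /r ltrDl divr_gt0.
have r0 : 0 < r by apply: lt_trans r1.
have lnr : 0 < ln r by rewrite ln_gt0.
split.
- have [K K0 HK] := log_sqnorm_path rg li.
  pose c0 : R := ln (1 + sqnorm (AdM (1%g : G))).
  have {}HK q l : path_of_length g 1%g q l ->
    ((ln (1 + sqnorm (AdM q)))%:E <= c0%:E + K%:E * l)%E by exact: HK.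
  (* the summand 1 keeps the argument of ln positive for every n *)
  pose N2 : R := 2 * (n%:R * n%:R) + 1.
  have N20 : 0 < N2 by rewrite ltr_wpDl // mulr_ge0 // mulr_ge0.
  have K1 : 0 < K + 1 by rewrite ltr_wpDl.
  have low (t : R) : 0 <= t ->
      ((((t - 1) * ln r - ln N2 - c0) / (K + 1))%:E <= rdist g 1%g (p t))%E.
    move=> /Hp [k [a [/andP[_ tk] ae Ep]]].
    have gk := grow k a ae; rewrite -Ep in gk; move: (p t) gk {Ep} => q gk.
    have F0 : 0 < 1 + sqnorm (AdM q) by rewrite ltr_wpDr // sqnorm_ge0.
    have H1 : r ^+ k <= N2 * (1 + sqnorm (AdM q)).
      have := le_trans gk (sum_norm_le _).
      rewrite ler_pdivrMr // => /le_trans; apply.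
      by rewrite mulrC mulrA ler_wpM2r ?(ltW F0) // lerDl.
    have H2 : k%:R * ln r <= ln N2 + ln (1 + sqnorm (AdM q)).
      rewrite -lnM ?posrE // mulr_natl -lnXn // ler_ln ?posrE ?exprn_gt0 //.
      by rewrite mulr_gt0.
    have H3 : (t - 1) * ln r <= k%:R * ln r.
      by rewrite ler_wpM2r ?(ltW lnr) // lerBlDr natr1 ltW.
    apply/ereal_infP => l /= pl; have := HK _ _ pl.
    have l0 : (0 <= l)%E.
      elim: pl {HK} => [|? ? gamma _ l0 _ _] //; apply: adde_ge0 => //.
      by apply: integral_ge0 => s _; rewrite lee_fin sqrtr_ge0.
    case: l l0 {pl} => [l l0 H| _ _|//]; last by rewrite leey.
    move: l0 H; rewrite -EFinM -EFinD !lee_fin => l0 H.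
    rewrite ler_pdivrMr // mulrDr mulr1 [l * K]mulrC.
    lra.
  apply/cvgeyPge => M; near=> t.
  have t0 : 0 <= t by near: t; exact: nbhs_pinfty_ge (num_real _).
  apply: le_trans (low _ t0); rewrite lee_fin ler_pdivlMr //.
  have tM : (M * (K + 1) + c0 + ln N2) / ln r + 1 <= t.
    by near: t; exact: nbhs_pinfty_ge (num_real _).
  move: tM; rewrite -lerBrDr ler_pdivrMr //; lra.
- have [L L0 HL] := rdist_steps rg li e0 xe.
  have [K K0 HK] := AdM_opnorm rg.
  have L1 : 0 < L + 1 by rewrite ltr_wpDl.
  have K1 : 0 < K + 1 by rewrite ltr_wpDl.
  exists (ln r / (L + 1)), ((2 * (K + 1) * r)^-1); split.
  + by rewrite divr_gt0.
  + by rewrite invr_gt0 !mulr_gt0.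
  move=> t /Hp [k [a [_ ae Ep]]]; have dL := HL k a ae.
  have gS := grow k a ae; rewrite -Ep in gS dL; have SK := HK (p t).
  move: (p t) dL gS SK {Ep} => q dL gS SK.
  have c0 : 0 < ln r / (L + 1) by rewrite divr_gt0.
  have dr : ((ln r / (L + 1))%:E * rdist g 1%g q <= (k.+1%:R * ln r)%:E)%E.
    apply: le_trans (_ : (ln r / (L + 1))%:E * (k.+1%:R * L)%:E <= _)%E.
      by apply: lee_wpmul2l; rewrite // lee_fin ltW.
    rewrite -EFinM lee_fin mulrAC ler_pdivrMr // mulrCA -mulrA ler_wpM2l //.
    by rewrite ler_wpM2l ?(ltW lnr) // lerDl.
  have er : (expeR ((ln r / (L + 1))%:E * rdist g 1%g q) <= (r ^+ k.+1)%:E)%E.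
    apply: le_trans (_ : expeR (k.+1%:R * ln r)%:E <= _)%E; first by rewrite lee_expeR.
    by rewrite /= lee_fin expRM_natl lnK.
  apply: le_trans (_ : ((2 * (K + 1) * r)^-1)%:E * (r ^+ k.+1)%:E <= _)%E.
    by apply: lee_wpmul2l; rewrite // lee_fin ltW // invr_gt0 !mulr_gt0.
  rewrite -EFinM lee_fin.
  have rk : 0 < r ^+ k by rewrite exprn_gt0.
  have -> : (2 * (K + 1) * r)^-1 * r ^+ k.+1 = (r ^+ k / 2) / (K + 1).
    by rewrite exprS; field; rewrite !gt_eqF.
  have S0 : 0 < \sum_i \sum_j `|AdM q i j|.
    by apply: lt_le_trans gS; rewrite divr_gt0.
  have o0 : 0 <= opnorm (g 1%g) (Ad q).
    rewrite leNgt; apply/negP => o0; have := lt_le_trans S0 SK.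
    by rewrite ltNge mulr_ge0_le0 // ltW.
  rewrite ler_pdivrMr //; apply: le_trans gS _; apply: le_trans SK _.
  by rewrite mulrC ler_wpM2l // lerDl.
Unshelve. all: by end_near. Qed.
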